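(* Let $n\ge2$, $\mu\ge2$, let $f=(f_1,\dots,f_n)$ be a polynomial system on $\mathbb{C}^n$ and let $\xi$ be a simple multiple zero of $f$ of multiplicity $\mu$ (so $f(\xi)=0$ and $\dim\ker Df(\xi)=1$; $Df(\xi)$ need not have normalized form). Let $z$ be an approximate zero of $f$ associated to $\xi$, and suppose $$\hat\gamma_\mu(f,z)\,\|z-\xi\|<\tfrac12 .$$ Then the refined solution $N_f(z)$ produced by one step of the modified Newton iteration described in the context satisfies $$\|N_f(z)-\xi\|=O(\|z-\xi\|^2)$$ (as $z\to\xi$, with $f$ and $\xi$ fixed).
   Context: Notation. For a system $F=(F_1,\dots,F_n)$ write $\hat F=(F_1,\dots,F_{n-1})$, $X=(X_1,\hat X)$ with $\hat X=(X_2,\dots,X_n)$. $DF$ is the full Jacobian, $D\hat F$ the $(n-1)\times(n-1)$ Jacobian of $\hat F$ with respect to $\hat X$; $D^k\hat F$ ($k\ge2$) is the $k$-th derivative with respect to all variables. $\|\cdot\|$ is the Hermitian/operator norm, $\|\cdot\|_F$ the Frobenius norm, $^*$ the Hermitian transpose. Singular values are in decreasing order. Differential functionals at a point $p$: $d_1^{\alpha_1}\cdots d_n^{\alpha_n}(h)=\frac{1}{\alpha!}\partial^\alpha h(p)$. $\Psi_\sigma$ is linear with $\Psi_\sigma(d_1^{\alpha_1}\cdots d_n^{\alpha_n})=d_\sigma^{\alpha_\sigma+1}d_{\sigma+1}^{\alpha_{\sigma+1}}\cdots d_n^{\alpha_n}$ if $\alpha_1=\dots=\alpha_{\sigma-1}=0$,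 and $0$ otherwise. Given $F$ with $D\hat F(p)$ invertible, set $a_{1,1}=1$, $a_{1,\sigma}=0$ ($\sigma\ge2$), $\Delta_1=\Lambda_1=d_1$, $a_{k,1}=0$ ($k\ge2$), and for $k\ge2$: $\Delta_k=\sum_{\sigma=1}^n\Psi_\sigma(a_{1,\sigma}\Lambda_{k-1}+\cdots+a_{k-1,\sigma}\Lambda_1)$, $\Lambda_k=\Delta_k+\sum_{\sigma\ge2}a_{k,\sigma}d_\sigma$, $(a_{k,2},\dots,a_{k,n})^T=-D\hat F(p)^{-1}(\Delta_k(F_1),\dots,\Delta_k(F_{n-1}))^T$. Simple multiple zero of multiplicity $\mu$: $f(\xi)=0$, $\dim\ker Df(\xi)=1$, and, with a singular value decomposition $Df(\xi)=U_0\,\mathrm{diag}(\Sigma,0)\,V_0^*$, $V_0=(v_1,\dots,v_n)$, $W_0=(v_n,v_1,\dots,v_{n-1})$, $F(X)=U_0^*f(W_0X)$, $p=W_0^*\xi$ (so that $DF(p)=\begin{pmatrix}0&\Sigma\\0&0\end{pmatrix}$), one has $\Delta_k(F_n)=0$ for $2\le k\le\mu-1$ and $\Delta_\mu(F_n)\neq0$ at $p$. Modified Newton iteration $N_f(z)$ (input $f,z,\mu$): 1. Take a singular value decomposition $Df(z)=U\,\mathrm{diag}(\Sigma_{n-1},\sigma_n)\,V^*$, $V=(v_1,\dots,v_n)$, $W_\dagger=(v_n,v_1,\dots,v_{n-1})$. 2. Put $F(X)=U^*f(W_\dagger X)$ and $a=(a_1,\hat a)=W_\dagger^*z$. 3.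 Put $\hat y=\hat a-D\hat F(a)^{-1}\hat F(a)$ and $y=(a_1,\hat y)$. 4. Take a singular value decomposition of $DF(y)$ with factors $U',V'$, $V'=(v'_1,\dots,v'_n)$, and $W_\ddagger=(v'_n,v'_1,\dots,v'_{n-1})$. 5. Put $g(X)=U'^*F(W_\ddagger X)$ and $w=(w_1,\hat w)=W_\ddagger^*y$. 6. With differential functionals taken at the point $w$, let $\Delta_k$ be computed from $g$ by the recursion $a_{1,1}=1$, $a_{1,\sigma}=0$ ($\sigma\ge2$), $\Delta_1=\Lambda_1=d_1$, $a_{k,1}=0$ ($k\ge2$), and for $k\ge2$: $\Delta_k=\sum_{\sigma=1}^n\Psi_\sigma(a_{1,\sigma}\Lambda_{k-1}+\cdots+a_{k-1,\sigma}\Lambda_1)$, $(a_{k,2},\dots,a_{k,n})^T=-D\hat g(w)^{-1}(\Delta_k(g_1),\dots,\Delta_k(g_{n-1}))^T$, $\Lambda_k=\Delta_k+\sum_{\sigma\ge2}a_{k,\sigma}d_\sigma$. Put $x_1=w_1-\frac1\mu\Delta_\mu(g_n)^{-1}\Delta_{\mu-1}(g_n)$ and $x=(x_1,\hat w)$. 7. $N_f(z)=W_\dagger W_\ddagger x$. The quantity $\hat\gamma_\mu(f,z)$ is computed in the coordinates obtained after Step 2: $\hat\gamma_\mu(f,z)=\max\{1,\sup_{k\ge2}\|D\hat F(a)^{-1}\frac{D^k\hat F(a)}{k!}\|^{1/(k-1)}\}$. Standing assumption: $\|DF(y)-DF(a)\|_F\le\delta/5$, where $\delta=\sigma_{n-1}-\sigma_n$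 is the gap between the two smallest singular values of $Df(z)$ and $\delta=O(1)$ (bounded away from $0$). *)

(* Defs.v *)
From HB Require Import structures.
From mathcomp Require Import all_boot all_order all_algebra.
From mathcomp Require Import classical_sets reals.
From mathcomp Require exp.
From mathcomp Require Import complex.
From mathcomp Require Import mpoly.

Set Implicit Arguments.
Unset Strict Implicit.
Unset Printing Implicit Defensive.

Import Order.TTheory GRing.Theory Num.Theory.
Local Open Scope ring_scope.
Local Open Scope sesquilinear_scope.

(* The dimension n of the ambient space C^n is written m.+1, so that hatted
   objects (the first n - 1 equations, the last n - 1 variables) have size m.
   Indices start at 0: X_1 is 'X_ord0 and F_n is F ord_max 0. *)

Definition polysys (R : realType) (n : nat) := 'cV[{mpoly R[i][n]}]_n.

Section Norms.
Variable R : realType.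
Local Notation C := R[i].

Definition cabs (x : C) : R := complex.Re `|x|.

Definition hnorm n (v : 'cV[C]_n) : R := Num.sqrt (\sum_i cabs (v i 0) ^+ 2).

Definition fnorm n p (A : 'M[C]_(n, p)) : R :=
  Num.sqrt (\sum_i \sum_j cabs (A i j) ^+ 2).

(* Operator norm of a k-linear map on C^p. *)
Definition opnorm k p n (A : ('I_k -> 'cV[C]_p) -> 'cV[C]_n) : R :=
  sup [set t | exists2 v : 'I_k -> 'cV[C]_p,
                 (forall l, hnorm (v l) <= 1) & t = hnorm (A v)]%classic.

End Norms.

Section SingularValues.
Variable R : realType.
Local Notation C := R[i].

Definition is_svd n (A U : 'M[C]_n) (S : 'rV[R]_n) (V : 'M[C]_n) : Prop :=
  [/\ U \is unitarymx, V \is unitarymx,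
      forall i, 0 <= S 0 i,
      forall i j : 'I_n, (i <= j)%N -> S 0 j <= S 0 i
    & A = U *m diag_mx (map_mx (real_complex R) S) *m V ^t* ].

(* (v_1, ..., v_n) |-> (v_n, v_1, ..., v_(n-1)) *)
Definition rotcols n (V : 'M[C]_n) : 'M[C]_n := colsub (@ord_pred n) V.

(* sigma_(n-1) - sigma_n; meaningful for n = m.+1 >= 2. *)
Definition sv_gap m (S : 'rV[R]_m.+1) : R := S 0 (inord m.-1) - S 0 ord_max.

End SingularValues.

Section Systems.
Variable R : realType.
Local Notation C := R[i].

Definition seval n (F : polysys R n) (x : 'cV[C]_n) : 'cV[C]_n :=
  \col_i (F i 0).@[fun j => x j 0].

Definition jacobian n (F : polysys R n) (x : 'cV[C]_n) : 'M[C]_n :=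
  \matrix_(i, j) ((F i 0)^`M(j)).@[fun l => x l 0].

(* The system U^* F(W X). *)
Definition unitary_change n (U W : 'M[C]_n) (F : polysys R n) : polysys R n :=
  map_mx (@mpolyC n C) (U ^t*) *m
  map_mx (comp_mpoly [tuple \sum_(l < n) W k l *: 'X_l | k < n]) F.

Variable m : nat.
Implicit Types (F : polysys R m.+1) (x : 'cV[C]_m.+1).

Definition vhat x : 'cV[C]_m := \col_j x (lift ord0 j) 0.

Definition vcons (x1 : C) (xh : 'cV[C]_m) : 'cV[C]_m.+1 :=
  \col_i (if unlift ord0 i is Some j then xh j 0 else x1).

Definition seval_hat F x : 'cV[C]_m := \col_i seval F x (lift ord_max i) 0.

Definition jacobian_hat F x : 'M[C]_m :=
  \matrix_(i, j) jacobian F x (lift ord_max i) (lift ord0 j).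

(* D^k \hat F(x) as a k-linear map; derivatives in all m.+1 variables. *)
Definition deriv_hat k F x (v : 'I_k -> 'cV[C]_m.+1) : 'cV[C]_m :=
  \col_i \sum_(J : {ffun 'I_k -> 'I_m.+1})
    (foldr (fun l p => p^`M(J l)) (F (lift ord_max i) 0) (enum 'I_k)).@[fun j => x j 0]
    * \prod_l v l (J l) 0.

(* Since F is polynomial, D^k \hat F(x) = 0 for large k and the supremum is
   that of a bounded set. *)
Definition gamma_hat F x : R :=
  Num.max 1
    (sup [set t | exists2 k, (2 <= k)%N &
       t = exp.powR
             (opnorm (fun v : 'I_k -> 'cV[C]_m.+1 =>
                k`!%:R^-1 *: (invmx (jacobian_hat F x) *m deriv_hat F x v)))
             (k.-1%:R^-1)]%classic).

End Systems.

(* A differential functional sum_alpha c_alpha d_1^alpha_1 ... d_n^alpha_n is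
   encoded by the polynomial in the symbols d_1, ..., d_n with the same
   coefficients: d_s is 'X_s. *)
Section LocalDual.
Variable R : realType.
Local Notation C := R[i].

Definition dapply n (x : 'cV[C]_n) (L h : {mpoly C[n]}) : C :=
  \sum_(al <- msupp L)
    L@_al * (\prod_(i < n) (al i)`!)%N%:R^-1 * (h^`M[al]).@[fun j => x j 0].

Definition Psi n (s : 'I_n) (L : {mpoly C[n]}) : {mpoly C[n]} :=
  \sum_(al <- msupp L | [forall i : 'I_n, (i < s)%N ==> (al i == 0%N)])
    L@_al *: 'X_[(al + U_(s))%MM].

Variable m : nat.
Local Notation functional := {mpoly C[m.+1]}.
Local Notation history := (seq (functional * 'cV[C]_m.+1)).

(* On the history [:: (Lambda_1, a_1); ...; (Lambda_(k-1), a_(k-1))], where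
   a_j = (a_(j,1), ..., a_(j,n)), this is
   sum_s Psi_s (a_(1,s) Lambda_(k-1) + ... + a_(k-1,s) Lambda_1). *)
Definition next_Delta (h : history) : functional :=
  \sum_(s < m.+1) Psi s
    (\sum_(j < size h) (nth (0, 0) h j).2 s 0 *: (nth (0, 0) h (size h - j.+1)).1).

Variables (F : polysys R m.+1) (x : 'cV[C]_m.+1).

(* lambda_history k = [:: (Lambda_1, a_1); ...; (Lambda_k, a_k)] *)
Fixpoint lambda_history (k : nat) : history :=
  match k with
  | 0 => [::]
  | 1 => [:: ('X_ord0, delta_mx ord0 0)]
  | k'.+1 =>
      let h := lambda_history k' in
      let D := next_Delta h in
      let ahat := - (invmx (jacobian_hat F x) *m
                     \col_i dapply x D (F (lift ord_max i) 0)) in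
      rcons h (D + \sum_(s < m) ahat s 0 *: 'X_(lift ord0 s), vcons 0 ahat)
  end.

Definition Delta (k : nat) : functional :=
  if k == 1%N then 'X_ord0 else next_Delta (lambda_history k.-1).

End LocalDual.

Definition simple_multiple_zero (R : realType) (m : nat)
    (f : polysys R m.+1) (xi : 'cV[R[i]]_m.+1) (mu : nat) : Prop :=
  [/\ seval f xi = 0,
      (* dim ker Df(xi) = 1; kermx is a row kernel, hence the transpose *)
      \rank (kermx (jacobian f xi)^T) = 1%N
    & exists U0 S0 V0,
        [/\ is_svd (jacobian f xi) U0 S0 V0, S0 0 ord_max = 0
          & let W0 := rotcols V0 in
            let F := unitary_change U0 W0 f in
            let p := W0 ^t* *m xi in
            (forall k, (2 <= k <= mu.-1)%N ->
               dapply p (Delta F p k) (F ord_max 0) = 0) /\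
            dapply p (Delta F p mu) (F ord_max 0) != 0]].

(* One modified Newton step from z. (U, V) are the factors of the singular
   value decomposition of Df(z), (U', V') those of DF(y). *)
Section ModifiedNewton.
Variables (R : realType) (m : nat).
Local Notation C := R[i].
Variables (f : polysys R m.+1) (z : 'cV[C]_m.+1) (U V : 'M[C]_m.+1).

Definition newtonF : polysys R m.+1 := unitary_change U (rotcols V) f.
Definition newton_a : 'cV[C]_m.+1 := (rotcols V) ^t* *m z.

Definition newton_y : 'cV[C]_m.+1 :=
  vcons (newton_a ord0 0)
    (vhat newton_a -
     invmx (jacobian_hat newtonF newton_a) *m seval_hat newtonF newton_a).

Variables (U' V' : 'M[C]_m.+1).

Definition newton_g : polysys R m.+1 := unitary_change U' (rotcols V') newtonF.
Definition newton_w : 'cV[C]_m.+1 := (rotcols V') ^t* *m newton_y.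

Definition newton_Delta_gn (k : nat) : C :=
  dapply newton_w (Delta newton_g newton_w k) (newton_g ord_max 0).

Definition newton_x (mu : nat) : 'cV[C]_m.+1 :=
  vcons (newton_w ord0 0 -
         mu%:R^-1 * (newton_Delta_gn mu)^-1 * newton_Delta_gn mu.-1)
        (vhat newton_w).

Definition newton_N (mu : nat) : 'cV[C]_m.+1 :=
  rotcols V *m rotcols V' *m newton_x mu.

(* Every inverse taken during the step exists. *)
Definition newton_defined (mu : nat) : Prop :=
  [/\ jacobian_hat newtonF newton_a \in unitmx,
      jacobian_hat newton_g newton_w \in unitmx
    & newton_Delta_gn mu != 0].

End ModifiedNewton.

(* Main.v *)
Require Import Defs.
From mathcomp Require Import all_boot all_order all_algebra.
From mathcomp Require Import reals complex.
From mathcomp Require Import boolp mpoly ring zify.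

(** The functionals [Lambda_k], built from the vectors [a_k], extract coefficients
along a polynomial curve: with [v(t) = sum_k a_k t^k],
[[
   Lambda_k(h) = [t^k] h(x + v(t)),
]]
because the generating function of the [Lambda_k] is the geometric series
[prod_s 1 / (1 - v_s d_s)], and the operators [Psi_s] split that product
according to the first variable that occurs in a monomial ([mcoeff_Lambda],
[dapply_coef]).  The choice of the [a_k] cancels the first equations along the
curve ([peval_hat_curve]), and when the Jacobian comes from a singular value
decomposition the numbers [Delta_k] of the last equation are exactly the
coefficients of that equation along the curve ([peval_last_curve]).

The whole argument is a calculus of families indexed by the possible runs of the
iteration, where [eps = |z - xi|] is the small quantity and [O(eps^k)] is uniform
in the run ([bigO], [away]).

Singular vectors.  Any singular value decomposition of a matrix close to
[Df(xi)], which has corank one, has its last singular value [O(eps)], the others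
bounded away from zero, and its last singular vectors within [O(eps)] of those of
[Df(xi)] up to a phase ([svd_last_small], [svd_away], [svd_Phi_col],
[svd_Phi_row], [svd_T_last]).

First stage.  The partial Newton step yields a point [zeta] such that
[zeta - xi] is [O(eps^2)] orthogonally to the last right singular vector and
[O(eps)] along it ([first_lift], [first_ord0], [zeta_hat_near]).

Second stage.  Let [w] be [zeta] in the last coordinates, let [X(t)] be the curve
of the recursion at [w], and let [H(t)] be the last equation along it, while
the other equations are [O(eps^2)] there.  Let [tau = O(eps)] be the exact
correction of the first coordinate.  Recentring [X] at [t = tau] moves its base
point to [xi] up to [O(eps^2)], and the terms of degree above [mu] contribute
[O(tau^2)] to the coefficients of degree below [mu].  The recentred curve is
then compared with the curve of the recursion at [xi], reparametrised so that the
first coordinates agree.  Along the latter the reference system vanishes to order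
[mu] with a nonzero leading coefficient in the last equation.  An induction on
the degree shows that the two curves agree up to [O(eps^2)] in degrees below [mu]
([deviation_small]): in each degree the first equations determine the
coefficient of the curve and the last one the coefficient of [H(t + tau)].
Consequently the coefficient of degree [mu - 1] of [H(t + tau)], which is
[H_(mu-1) + mu tau H_mu], is [O(eps^2)] ([penultimate_coef_small]), and [H_mu]
stays away from zero ([leading_coef_away]).  Hence
[- H_(mu-1) / (mu H_mu) = tau + O(eps^2)]: the correction made by the iteration is
the exact one up to [O(eps^2)]. *)

Set Implicit Arguments.
Unset Strict Implicit.
Unset Printing Implicit Defensive.

Import Order.TTheory GRing.Theory Num.Theory.
Local Open Scope ring_scope.

(** * Asymptotic estimates for families of complex numbers *)

Section Cabs.
Variable R : realType.
Local Notation C := R[i].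
Implicit Types x y : C.

Lemma cabsE x : (cabs x)%:C%C = `|x|.
Proof. by rewrite /cabs normc_def. Qed.

Lemma cabs_ge0 x : 0 <= cabs x.
Proof. by rewrite -lecR cabsE normr_ge0. Qed.

Lemma cabsM x y : cabs (x * y) = cabs x * cabs y.
Proof. by apply: complexI; rewrite rmorphM /= !cabsE normrM. Qed.

Lemma cabsD x y : cabs (x + y) <= cabs x + cabs y.
Proof. by rewrite -lecR rmorphD /= !cabsE ler_normD. Qed.

Lemma cabsN x : cabs (- x) = cabs x.
Proof. by rewrite /cabs normrN. Qed.

Lemma cabsB x y : cabs (x - y) = cabs (y - x).
Proof. by rewrite /cabs distrC. Qed.

Lemma cabs0 : cabs (0 : C) = 0.
Proof. by rewrite /cabs normr0. Qed.

Lemma cabs1 : cabs (1 : C) = 1.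
Proof. by rewrite /cabs normr1. Qed.

Lemma cabsV x : cabs x^-1 = (cabs x)^-1.
Proof.
by apply: complexI; rewrite cabsE normfV -cabsE fmorphV.
Qed.

Lemma cabs_conj x : cabs (x^* ) = cabs x.
Proof. by apply: complexI; rewrite !cabsE norm_conjC. Qed.

Lemma cabs_eq0 x : (cabs x == 0) = (x == 0).
Proof. by rewrite -[RHS]normr_eq0 -cabsE -(inj_eq (@complexI _)). Qed.

End Cabs.

Section BigO.
Variables (R : realType) (P : Type) (eps : P -> R).
Local Notation C := R[i].
Implicit Types (x y : P -> C) (Q : P -> Prop).

Definition near0 Q := exists2 r : R, 0 < r & forall p, `|eps p| < r -> Q p.

(** The absolute value makes these notions meaningful for any family
    [eps]; for [eps = 0] and [k > 0] they express an equality. *)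
Definition bigO k x := exists K, near0 (fun p => cabs (x p) <= K * `|eps p| ^+ k).

Definition away x := exists2 c : R, 0 < c & near0 (fun p => c <= cabs (x p)).

Lemma near0T Q : (forall p, Q p) -> near0 Q.
Proof. by move=> h; exists 1. Qed.

Lemma near0I Q1 Q2 : near0 Q1 -> near0 Q2 -> near0 (fun p => Q1 p /\ Q2 p).
Proof.
move=> [r r0 h] [s s0 k]; exists (Num.min r s); first by rewrite lt_min r0.
by move=> p; rewrite lt_min => /andP[/h ? /k].
Qed.

Lemma near0W Q1 Q2 : (forall p, Q1 p -> Q2 p) -> near0 Q1 -> near0 Q2.
Proof. by move=> h [r r0 k]; exists r => // p /k/h. Qed.

Lemma near0_all (I : finType) (Q : I -> P -> Prop) :
  (forall i, near0 (Q i)) -> near0 (fun p => forall i, Q i p).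
Proof.
move=> h.
have: near0 (fun p => forall i, i \in enum I -> Q i p).
  elim: (enum I) => [|i s ih]; first exact: near0T.
  apply: near0W (near0I (h i) ih) => p [hi hs] j.
  by rewrite inE => /orP[/eqP->|/hs].
by apply: near0W => p hp i; apply: hp; rewrite mem_enum.
Qed.

Lemma bigO_le_cabs k x y :
  near0 (fun p => cabs (x p) <= cabs (y p)) -> bigO k y -> bigO k x.
Proof.
move=> h [K hy]; exists K; apply: near0W (near0I h hy) => p [].
exact: le_trans.
Qed.

Lemma bigO_near k x y : near0 (fun p => x p = y p) -> bigO k y -> bigO k x.
Proof. by move=> h; apply: bigO_le_cabs; apply: near0W h => p ->. Qed.

Lemma bigO_ext k x y : (forall p, x p = y p) -> bigO k y -> bigO k x.
Proof. by move=> h; apply: bigO_near; apply: near0T. Qed.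

Lemma bigO0 k : bigO k (fun=> 0).
Proof. by exists 0; apply: near0T => p; rewrite cabs0 mul0r. Qed.

Lemma bigO_cst c : bigO 0 (fun=> c).
Proof. by exists (cabs c); apply: near0T => p; rewrite mulr1. Qed.

Lemma bigO_bound K x : (forall p, cabs (x p) <= K) -> bigO 0 x.
Proof. by move=> h; exists K; apply: near0T => p; rewrite mulr1. Qed.

Lemma bigOD k x y : bigO k x -> bigO k y -> bigO k (fun p => x p + y p).
Proof.
move=> [K hx] [K' hy]; exists (K + K').
apply: near0W (near0I hx hy) => p [h h'].
by rewrite mulrDl; apply: le_trans (cabsD _ _) (lerD h h').
Qed.

Lemma bigON k x : bigO k x -> bigO k (fun p => - x p).
Proof. by apply: bigO_le_cabs; apply: near0T => p; rewrite cabsN. Qed.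

Lemma bigOB k x y : bigO k x -> bigO k y -> bigO k (fun p => x p - y p).
Proof. by move=> hx /bigON; apply: bigOD. Qed.

Lemma bigOM j k x y : bigO j x -> bigO k y -> bigO (j + k) (fun p => x p * y p).
Proof.
move=> [K hx] [K' hy]; exists (K * K').
apply: near0W (near0I hx hy) => p [h h'].
by rewrite cabsM exprD mulrACA ler_pM ?cabs_ge0.
Qed.

Lemma bigOMl k x y : bigO 0 x -> bigO k y -> bigO k (fun p => x p * y p).
Proof. exact: bigOM. Qed.

Lemma bigOMr k x y : bigO k x -> bigO 0 y -> bigO k (fun p => x p * y p).
Proof. by move=> hx hy; rewrite -[k]addn0; apply: bigOM. Qed.

Lemma bigOW j k x : (k <= j)%N -> bigO j x -> bigO k x.
Proof.
move=> kj [K hx]; exists `|K|.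
have h1 : near0 (fun p => `|eps p| < 1) by exists 1.
apply: near0W (near0I hx h1) => p [h h'].
apply: le_trans h _; apply: le_trans (ler_wpM2r (exprn_ge0 _ _) (ler_norm K)) _ => //.
apply: ler_wpM2l => //; rewrite -(subnK kj) exprD.
by apply: ler_piMl; rewrite ?exprn_ge0// exprn_ile1// ltW.
Qed.

Lemma bigO_sum k (I : Type) (s : seq I) (Q : pred I) (F : I -> P -> C) :
  (forall i, Q i -> bigO k (F i)) -> bigO k (fun p => \sum_(i <- s | Q i) F i p).
Proof.
move=> h; elim: s => [|i s ih].
  by apply: bigO_ext (bigO0 k) => p; rewrite big_nil.
case hi: (Q i).
  apply: bigO_ext (bigOD (h _ hi) ih) => p.
  by rewrite big_cons hi.
by apply: bigO_ext ih => p; rewrite big_cons hi.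
Qed.

Lemma bigO_conj k x : bigO k x -> bigO k (fun p => (x p)^* ).
Proof. by apply: bigO_le_cabs; apply: near0T => p; rewrite cabs_conj. Qed.

Lemma bigOX k x n : bigO k x -> bigO (k * n) (fun p => x p ^+ n).
Proof.
move=> hx; elim: n => [|n ih]; first by rewrite muln0; apply: bigO_ext (bigO_cst 1).
by rewrite mulnS; apply: bigO_ext (bigOM hx ih) => p; rewrite exprS.
Qed.

Lemma bigO_bigsum k x (n : nat) (F : 'I_n -> P -> C) :
  (forall p, x p = \sum_i F i p) -> (forall i, bigO k (F i)) -> bigO k x.
Proof. by move=> e h; apply: bigO_ext e _; apply: bigO_sum. Qed.

Lemma away_cst c : c != 0 -> away (fun=> c).
Proof.
by move=> c0; exists (cabs c); [rewrite lt_def cabs_eq0 c0 cabs_ge0|apply: near0T].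
Qed.

Lemma away_neq0 x : away x -> near0 (fun p => x p != 0).
Proof.
move=> [c c0]; apply: near0W => p h.
by rewrite -cabs_eq0 gt_eqF// (lt_le_trans c0).
Qed.

Lemma bigOV x : away x -> bigO 0 (fun p => (x p)^-1).
Proof.
move=> [c c0 h]; exists c^-1; apply: near0W h => p h.
by rewrite mulr1 cabsV lef_pV2// posrE (lt_le_trans c0).
Qed.

Lemma awayX x n : away x -> away (fun p => x p ^+ n).
Proof.
move=> [c c0 h]; exists (c ^+ n); first exact: exprn_gt0.
apply: near0W h => p h; elim: n => [|n ih]; first by rewrite !expr0 cabs1.
by rewrite !exprS cabsM ler_pM// ?ltW// exprn_gt0.
Qed.

Lemma awayM x y : away x -> away y -> away (fun p => x p * y p).
Proof.
move=> [c c0 h] [d d0 k]; exists (c * d); first exact: mulr_gt0.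
by apply: near0W (near0I h k) => p [? ?]; rewrite cabsM ler_pM// ltW.
Qed.

Lemma away_perturb x y : away x -> bigO 1 (fun p => y p - x p) -> away y.
Proof.
move=> [c c0 h] [K k]; exists (c / 2%:R); first by rewrite divr_gt0.
have small : near0 (fun p => `|K| * `|eps p| <= c / 2%:R).
  exists (c / 2%:R / (`|K| + 1)) => [|p].
    by rewrite !divr_gt0// ltr_wpDl.
  rewrite ltr_pdivlMr ?ltr_wpDl// => /ltW; apply: le_trans.
  by rewrite mulrC ler_wpM2l// lerDl.
apply: near0W (near0I small (near0I h k)) => p [hs [hx hy]].
have: cabs (x p) <= cabs (y p) + cabs (y p - x p).
  rewrite -[x p in X in X <= _](subrK (y p)) addrC; apply: le_trans (cabsD _ _) _.
  by rewrite cabsB.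
move: hy; rewrite expr1 => hy hxy.
have hK : K * `|eps p| <= `|K| * `|eps p| by rewrite ler_wpM2r// ler_norm.
have := le_trans hx hxy; have := le_trans hy (le_trans hK hs).
move=> h1 h2; rewrite -(lerD2r (c / 2%:R)) -splitr.
by apply: le_trans h2 _; rewrite lerD2l.
Qed.

Lemma away_factor x y : bigO 0 x -> away (fun p => x p * y p) -> away y.
Proof.
move=> [K hx] [c c0 h]; exists (c / (`|K| + 1)); first by rewrite divr_gt0// ltr_wpDl.
apply: near0W (near0I hx h) => p []; rewrite mulr1 cabsM => h1 h2.
rewrite ler_pdivrMr ?ltr_wpDl//; apply: le_trans h2 _.
rewrite mulrC ler_wpM2l ?cabs_ge0//; apply: le_trans h1 _.
by apply: le_trans (ler_norm _) _; rewrite lerDl.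
Qed.

Lemma bigO_cancel k x y : away x -> bigO k (fun p => x p * y p) -> bigO k y.
Proof.
move=> ax h; apply: bigO_near (bigOMl (bigOV ax) h).
by apply: near0W (away_neq0 ax) => p x0; rewrite mulKf.
Qed.

End BigO.

(** * Polynomial systems along families of curves *)

(** Evaluation, composition and the classes of families below are all
    compatible with sums and products, so this is the induction that they need. *)
Lemma mpoly_ring_ind (A : comNzRingType) n (Q : {mpoly A[n]} -> Prop) :
  (forall c, Q c%:MP) -> (forall i, Q 'X_i) ->
  (forall g h, Q g -> Q h -> Q (g + h)) ->
  (forall g h, Q g -> Q h -> Q (g * h)) -> forall h, Q h.
Proof.
move=> QC QX QD QM; elim/mpolyind => [|c m h _ _ Qh].
  by rewrite -mpolyC0; apply: QC.
apply: (QD _ _ _ Qh); rewrite -mul_mpolyC; apply: (QM _ _ (QC c)).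
rewrite mpolyXE_id; elim/big_ind: _ => [||i _].
- by rewrite -mpolyC1; apply: QC.
- exact: QM.
- elim: (m i) => [|k ih]; first by rewrite expr0 -mpolyC1; apply: QC.
  by rewrite exprS; apply: QM.
Qed.

Section Taylor.
Variables (A S : comNzRingType) (phi : {rmorphism A -> S}) (P : Type) (n : nat).
Variables B J : (P -> S) -> Prop.
Hypothesis BC : forall c, B (fun=> phi c).
Hypothesis BD : forall x y, B x -> B y -> B (fun p => x p + y p).
Hypothesis BM : forall x y, B x -> B y -> B (fun p => x p * y p).
Hypothesis J0 : J (fun=> 0).
Hypothesis JD : forall x y, J x -> J y -> J (fun p => x p + y p).
Hypothesis JM : forall x y, B x -> J y -> J (fun p => x p * y p).

Lemma family_eval u : (forall i : 'I_n, B (fun p => u p i)) ->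
  forall h, B (fun p => mmap phi (u p) h).
Proof.
move=> Bu; elim/mpoly_ring_ind => [c|i|g h Bg Bh|g h Bg Bh].
- by rewrite (_ : (fun _ => _) = fun=> phi c)// funeqE => p; rewrite mmapC.
- rewrite (_ : (fun _ => _) = fun p => u p i)// funeqE => p.
  by rewrite mmapX mmap1U.
- rewrite (_ : (fun _ => _) = fun p => mmap phi (u p) g + mmap phi (u p) h).
    exact: BD.
  by rewrite funeqE => p; rewrite rmorphD.
- rewrite (_ : (fun _ => _) = fun p => mmap phi (u p) g * mmap phi (u p) h).
    exact: BM.
  by rewrite funeqE => p; rewrite rmorphM.
Qed.

Lemma family_sum (Q : (P -> S) -> Prop) (I : Type) (s : seq I) (F : I -> P -> S) :
  Q (fun=> 0) -> (forall x y, Q x -> Q y -> Q (fun p => x p + y p)) ->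
  (forall i, Q (F i)) -> Q (fun p => \sum_(i <- s) F i p).
Proof.
move=> Q0 QD QF; elim: s => [|i s ih].
  by rewrite (_ : (fun _ => _) = fun=> 0)// funeqE => p; rewrite big_nil.
rewrite (_ : (fun _ => _) = fun p => F i p + \sum_(i <- s) F i p).
  exact: QD.
by rewrite funeqE => p; rewrite big_cons.
Qed.

(** First-order Taylor expansion, with [B] a ring of families and [J] an
    ideal of [B] that contains the products of two increments.  Keeping [J]
    abstract gives at once the numerical remainder [O(eps^2)] and, for
    polynomial curves, the remainder in a given degree. *)
Lemma family_taylor u e :
  (forall i : 'I_n, B (fun p => u p i)) -> (forall i, B (fun p => e p i)) ->
  (forall i j, J (fun p => e p i * e p j)) ->
  forall h, J (fun p => mmap phi (fun i => u p i + e p i) h - mmap phi (u p) h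
                        - \sum_i mmap phi (u p) h^`M(i) * e p i).
Proof.
move=> Bu Be Jee; pose u' p i := u p i + e p i.
have Bu' i : B (fun p => u' p i) by apply: BD.
have B0 : B (fun=> 0) by have := BC 0; rewrite rmorph0.
pose T h p := \sum_i mmap phi (u p) h^`M(i) * e p i.
have BT h : B (T h).
  by apply: family_sum => // i; apply: BM => //; apply: family_eval.
elim/mpoly_ring_ind => [c|k|g h Jg Jh|g h Jg Jh].
- rewrite (_ : (fun _ => _) = fun=> 0)// funeqE => p.
  rewrite !mmapC subrr big1 ?subr0// => i _.
  by rewrite mderivC rmorph0 mul0r.
- rewrite (_ : (fun _ => _) = fun=> 0)// funeqE => p.
  rewrite !mmapX !mmap1U (bigD1 k)//= big1 => [|i ik].
    have Ukk : (U_(k) - U_(k))%MM = 0%MM :> 'X_{1..n}.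
      by apply/mnmP => i; rewrite !mnmE subnn.
    by rewrite mderivX mnm1E eqxx scale1r Ukk mpolyX0 rmorph1; ring.
  by rewrite mderivX mnm1E eq_sym (negPf ik) scale0r rmorph0 mul0r.
- set G := (X in J X) in Jg; set H := (X in J X) in Jh.
  rewrite (_ : (fun _ => _) = fun p => G p + H p); first exact: JD.
  rewrite funeqE => p; rewrite /G /H !rmorphD /=.
  under eq_bigr do rewrite mderivD rmorphD mulrDl.
  by rewrite big_split /=; ring.
- set G := (X in J X) in Jg; set H := (X in J X) in Jh.
  pose gu p := mmap phi (u p) g; pose hu' p := mmap phi (u' p) h.
  (* With [g(u+e) = g + Tg + G] and [h(u+e) = h + Th + H], the remainder of the
     product is [(g + Tg) H + h(u+e) G + Tg Th]. *)
  rewrite (_ : (fun _ => _) = fun p => (gu p + T g p) * H p + hu' p * G p + T g p * T h p).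
    apply: JD; first apply: JD; first apply: JM => //.
    + by apply: BD => //; apply: family_eval.
    + by apply: JM => //; apply: family_eval.
    rewrite (_ : (fun _ => _) = fun p => \sum_i \sum_j
        (mmap phi (u p) g^`M(i) * mmap phi (u p) h^`M(j)) * (e p i * e p j)).
      apply: family_sum => // i; apply: family_sum => // j; apply: JM => //.
      by apply: BM; apply: family_eval.
    rewrite funeqE => p; rewrite /T mulr_suml; apply: eq_bigr => i _.
    by rewrite mulr_sumr; apply: eq_bigr => j _; ring.
  rewrite funeqE => p; rewrite !rmorphM /=.
  have -> : \sum_i mmap phi (u p) (g * h)^`M(i) * e p i =
      T g p * mmap phi (u p) h + gu p * T h p.
    rewrite mulr_suml mulr_sumr -big_split /=; apply: eq_bigr => i _.
    by rewrite mderivM rmorphD !rmorphM /gu /=; ring.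
  by rewrite /G /H /gu /hu' /u' /T; ring.
Qed.

End Taylor.

Section PolyFamilies.
Variables (R : realType) (P : Type) (eps : P -> R).
Local Notation C := R[i].
Local Notation bigO := (bigO eps).
Implicit Types u v : P -> {poly C}.

(** The uniform bound on the sizes makes finite the sums that occur when
    such a family is translated. *)
Definition pbounded u :=
  (exists N, forall p, (size (u p) <= N)%N) /\ forall i, bigO 0 (fun p => (u p)`_i).

Definition lowO j k u := forall i, (i < k)%N -> bigO j (fun p => (u p)`_i).

Lemma pboundedC x : bigO 0 x -> pbounded (fun p => (x p)%:P).
Proof.
move=> hx; split; first by exists 1%N => p; rewrite size_polyC leq_b1.
case=> [|i]; first by apply: bigO_ext hx => p; rewrite coefC.
by apply: bigO_ext (bigO0 _ 0) => p; rewrite coefC.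
Qed.

Lemma pbounded_cst (q : {poly C}) : pbounded (fun=> q).
Proof. by split; [exists (size q)|move=> i; apply: bigO_cst]. Qed.

Lemma pboundedD u v : pbounded u -> pbounded v -> pbounded (fun p => u p + v p).
Proof.
move=> [[N hN] hu] [[M hM] hv]; split.
  exists (maxn N M) => p; apply: leq_trans (size_polyD _ _) _.
  by rewrite geq_max !leq_max hN hM orbT.
by move=> i; apply: bigO_ext (bigOD (hu i) (hv i)) => p; rewrite coefD.
Qed.

Lemma lowOM_sum j k u v : (forall i, bigO 0 (fun p => (v p)`_i)) ->
  lowO j k u -> lowO j k (fun p => u p * v p).
Proof.
move=> hv hu i ik; apply: bigO_bigsum (fun p => coefM _ _ _) _ => a.
by apply: bigOMr => //; apply: hu; rewrite (leq_ltn_trans _ ik)// -ltnS.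
Qed.

Lemma pboundedM u v : pbounded u -> pbounded v -> pbounded (fun p => u p * v p).
Proof.
move=> [[N hN] hu] [[M hM] hv]; split.
  exists (N + M)%N => p; apply: leq_trans (size_polyMleq _ _) _.
  by apply: leq_trans (leq_pred _) _; rewrite leq_add.
by move=> i; apply: (lowOM_sum hv (k := i.+1)) => // l _; apply: hu.
Qed.

Lemma pbounded_sum (I : Type) (s : seq I) (F : I -> P -> {poly C}) :
  (forall i, pbounded (F i)) -> pbounded (fun p => \sum_(i <- s) F i p).
Proof. by apply: family_sum; [apply: pbounded_cst|apply: pboundedD]. Qed.

Lemma lowO_ext j k u v : (forall p, u p = v p) -> lowO j k u -> lowO j k v.
Proof. by move=> e h i /h; apply: bigO_ext => p; rewrite e. Qed.

Lemma lowO0 j k : lowO j k (fun=> 0).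
Proof. by move=> i _; apply: bigO_ext (bigO0 _ j) => p; rewrite coef0. Qed.

Lemma lowOD j k u v : lowO j k u -> lowO j k v -> lowO j k (fun p => u p + v p).
Proof.
move=> hu hv i ik; apply: bigO_ext (bigOD (hu _ ik) (hv _ ik)) => p.
by rewrite coefD.
Qed.

Lemma lowOM j k u v : pbounded u -> lowO j k v -> lowO j k (fun p => u p * v p).
Proof.
move=> [_ hu] /(lowOM_sum hu); apply: lowO_ext => p; exact: mulrC.
Qed.

Lemma lowO_sum j k (I : Type) (s : seq I) (F : I -> P -> {poly C}) :
  (forall i, lowO j k (F i)) -> lowO j k (fun p => \sum_(i <- s) F i p).
Proof. by apply: family_sum; [apply: lowO0|apply: lowOD]. Qed.

(** In degree [k] the only product not covered by the smallness of [u] is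
    the one with the constant coefficient of [v]. *)
Lemma lowOM_succ j k u v : pbounded u -> pbounded v ->
  lowO j k u -> lowO j 1 v -> lowO j k.+1 (fun p => u p * v p).
Proof.
move=> [_ bu] [_ bv] hu hv i; rewrite ltnS => ik.
apply: bigO_bigsum (fun p => coefM _ _ _) _ => a.
have [ak|ka] := ltnP a k; first by apply: bigOMr (hu _ ak) (bv _).
apply: bigOMl (bu _) _; apply: hv; rewrite ltnS leqn0 subn_eq0.
exact: leq_trans ik ka.
Qed.

Definition peval n (X : 'I_n -> {poly C}) (h : {mpoly C[n]}) : {poly C} :=
  mmap (@polyC C) X h.

Variable n : nat.
Implicit Types (x : P -> 'I_n -> {poly C}) (h : {mpoly C[n]}).

Lemma pbounded_peval x h :
  (forall l, pbounded (fun p => x p l)) -> pbounded (fun p => peval (x p) h).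
Proof.
move=> bx; apply: (family_eval (phi := polyC)) => // [c|u v|u v].
- exact: pbounded_cst.
- exact: pboundedD.
- exact: pboundedM.
Qed.

Lemma coef0_peval (X : 'I_n -> {poly C}) h : (peval X h)`_0 = h.@[fun l => (X l)`_0].
Proof.
elim/mpoly_ring_ind: h => [c|i|g h hg hh|g h hg hh].
- by rewrite /peval mmapC mevalC coefC.
- by rewrite /peval mmapX mmap1U mevalXU.
- by rewrite mevalD -hg -hh -coefD /peval rmorphD.
- by rewrite mevalM -hg -hh -coef0M /peval rmorphM.
Qed.

Lemma lowO_taylor j k x e h :
  (forall l, pbounded (fun p => x p l)) -> (forall l, pbounded (fun p => e p l)) ->
  (forall l, lowO j k (fun p => e p l)) -> (forall l, lowO j 1 (fun p => e p l)) ->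
  lowO j k.+1 (fun p => peval (fun l => x p l + e p l) h - peval (x p) h
                        - \sum_l peval (x p) h^`M(l) * e p l).
Proof.
move=> bx be ek e1; apply: (family_taylor (phi := polyC) (B := pbounded)) => //.
- by move=> c; apply: pbounded_cst.
- exact: pboundedD.
- exact: pboundedM.
- exact: lowO0.
- exact: lowOD.
- by move=> u v; apply: lowOM.
- by move=> i l; apply: lowOM_succ.
Qed.

Lemma lowO_peval j k x e h :
  (forall l, pbounded (fun p => x p l)) -> (forall l, pbounded (fun p => e p l)) ->
  (forall l, lowO j k (fun p => e p l)) ->
  lowO j k (fun p => peval (fun l => x p l + e p l) h - peval (x p) h).
Proof.
case: k => [|k] bx be ek; first by [].
have e1 l : lowO j 1 (fun p => e p l) by move=> [|i] // _; apply: ek.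
have t := lowO_taylor h bx be ek e1.
have s : lowO j k.+1 (fun p => \sum_l peval (x p) h^`M(l) * e p l).
  by apply: lowO_sum => l; apply: lowOM => //; apply: pbounded_peval.
have tk : lowO j k.+1 (fun p => peval (fun l => x p l + e p l) h - peval (x p) h
                        - \sum_l peval (x p) h^`M(l) * e p l).
  by move=> i ik; apply: t; apply: ltnW.
by apply: lowO_ext (lowOD tk s) => p; rewrite subrK.
Qed.

(** If two curves agree up to [O(eps^j)] below degree [k], their values
    under [h] differ in degree [k] only through the linear part of [h].  This is
    what makes induction on the degree possible. *)
Lemma lowO_coef_peval j k x e h :
  (forall l, pbounded (fun p => x p l)) -> (forall l, pbounded (fun p => e p l)) ->
  (forall l, lowO j k (fun p => e p l)) -> (forall l, lowO j 1 (fun p => e p l)) ->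
  bigO j (fun p => (peval (fun l => x p l + e p l) h)`_k - (peval (x p) h)`_k
      - \sum_l h^`M(l).@[fun l => (x p l)`_0] * (e p l)`_k).
Proof.
move=> bx be ek e1; have t := lowO_taylor h bx be ek e1.
(* The terms of the product of series in which the increment appears in degree
   below [k]. *)
pose rest l a p := (peval (x p) h^`M(l))`_(bump 0 a) * (e p l)`_(k - bump 0 a).
have hr : bigO j (fun p => \sum_l \sum_(a < k) rest l a p).
  apply: bigO_sum => l _; apply: bigO_sum => a _.
  have [_ be'] := pbounded_peval h^`M(l) bx.
  apply: bigOMl (be' _) _; apply: ek.
  by rewrite /bump leq0n add1n subnS prednK ?subn_gt0// leq_subr.
apply: bigO_ext (bigOD (t k (leqnn _)) hr) => p.
rewrite !coefB.
have -> : (\sum_l peval (x p) h^`M(l) * e p l)`_k =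
    \sum_l h^`M(l).@[fun l => (x p l)`_0] * (e p l)`_k + \sum_l \sum_(a < k) rest l a p.
  rewrite coef_sum -big_split; apply: eq_bigr => l _.
  by rewrite coefM big_ord_recl subn0 coef0_peval.
by ring.
Qed.

End PolyFamilies.

(** * Differential functionals as coefficients along curves *)

Section ExactCoefficient.
Variables (R : realType) (n : nat).
Local Notation C := R[i].

Let eps0 : unit -> R := fun=> 0.

Lemma pbounded_unit (u : unit -> {poly C}) : pbounded eps0 u.
Proof.
split; first by exists (size (u tt)) => -[].
by move=> i; apply: (@bigO_bound _ _ _ (cabs (u tt)`_i)) => -[].
Qed.

Lemma bigO1_unit (x : unit -> C) : bigO eps0 1 x -> x tt = 0.
Proof.
move=> [K [r r0 /(_ tt)]]; rewrite normr0 mulr0 => /(_ r0) h.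
by apply/eqP; rewrite -cabs_eq0 eq_le h cabs_ge0.
Qed.

(** The exact version, obtained from the asymptotic one with a one-point
    family and [eps = 0], where [O(eps)] means equal to zero. *)
Lemma coef_peval_add (X E : 'I_n -> {poly C}) (h : {mpoly C[n]}) k : (0 < k)%N ->
  (forall l i, (i < k)%N -> (E l)`_i = 0) ->
  (peval (fun l => X l + E l) h)`_k =
  (peval X h)`_k + \sum_l h^`M(l).@[fun l => (X l)`_0] * (E l)`_k.
Proof.
move=> k0 hE.
have low j l : (j <= k)%N -> lowO eps0 1 j (fun=> E l).
  move=> jk i ij; apply: bigO_ext (bigO0 _ 1) => p.
  by rewrite hE// (leq_trans ij).
have := @lowO_coef_peval _ _ eps0 _ 1 k (fun=> X) (fun=> E) h
  (fun=> pbounded_unit _) (fun=> pbounded_unit _) (fun l => low k l (leqnn k))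
  (fun l => low 1%N l k0).
by move=> /bigO1_unit/eqP; rewrite -addrA -opprD subr_eq0 => /eqP.
Qed.

Lemma coef1_peval (X : 'I_n -> {poly C}) (h : {mpoly C[n]}) :
  (peval X h)`_1 = \sum_l h^`M(l).@[fun l => (X l)`_0] * (X l)`_1.
Proof.
have hX l : X l = ((X l)`_0)%:P + (X l - ((X l)`_0)%:P) by ring.
rewrite {1}(_ : X = fun l => ((X l)`_0)%:P + (X l - ((X l)`_0)%:P)); last exact/funext.
rewrite coef_peval_add => // [|l [|i] // _]; last by rewrite coefB coefC subrr.
have -> : peval (fun l => ((X l)`_0)%:P) h = (h.@[fun l => (X l)`_0])%:P.
  elim/mpoly_ring_ind: h => [c|i|g h hg hh|g h hg hh].
  - by rewrite /peval mmapC mevalC.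
  - by rewrite /peval mmapX mmap1U mevalXU.
  - by rewrite mevalD polyCD -hg -hh /peval rmorphD.
  - by rewrite mevalM polyCM -hg -hh /peval rmorphM.
rewrite coefC add0r; apply: eq_bigr => l _.
rewrite coefB coefC /= subr0; congr (_ * _); apply: meval_eq => a.
by rewrite coefC.
Qed.

End ExactCoefficient.

Lemma sum_uniq_support (T : eqType) (V : nmodType) (s1 s2 : seq T) (G : T -> V) :
  uniq s1 -> uniq s2 -> (forall a, G a != 0 -> (a \in s1) = (a \in s2)) ->
  \sum_(a <- s1) G a = \sum_(a <- s2) G a.
Proof.
move=> u1 u2 h.
have supp s : \sum_(a <- s) G a = \sum_(a <- [seq a <- s | G a != 0]) G a.
  rewrite big_filter (bigID (fun a => G a != 0))/= [X in _ + X]big1 ?addr0//.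
  by move=> a /negPn/eqP.
rewrite (supp s1) (supp s2); apply: perm_big; apply: uniq_perm; rewrite ?filter_uniq//.
by move=> a; rewrite !mem_filter; case: (boolP (G a != 0)) => // /h.
Qed.

Section Functionals.
Variables (R : realType) (n : nat).
Local Notation C := R[i].
Variables (x : 'cV[C]_n).

Let term (al : 'X_{1..n}) (h : {mpoly C[n]}) : C :=
  (\prod_(i < n) (al i)`!)%N%:R^-1 * (h^`M[al]).@[fun j => x j 0].

Lemma termX al be :
  term al 'X_[be] = \prod_i ('C(be i, al i)%:R * x i 0 ^+ (be i - al i)).
Proof.
rewrite /term mderivmX mevalZ mevalX natr_prod natr_prod -prodfV mulrA -!big_split /=.
apply: eq_bigr => i _; rewrite mnmE -bin_ffact natrM mulrCA mulVf ?mulr1//.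
by rewrite pnatr_eq0 -lt0n fact_gt0.
Qed.

(** Taylor's formula for a monomial, as a sum over a box of exponents.
    Exponents that do not divide [be] contribute a zero binomial coefficient. *)
Lemma peval_translate_monomial (v : 'I_n -> {poly C}) (be : 'X_{1..n}) D :
  (forall i, (be i < D)%N) ->
  peval (fun i => (x i 0)%:P + v i) 'X_[be] =
  \sum_(f : {ffun 'I_n -> 'I_D})
     (term [multinom (f i : nat) | i < n] 'X_[be])%:P
       * mmap1 v [multinom (f i : nat) | i < n].
Proof.
move=> hD; rewrite /peval mmapX /mmap1.
under eq_bigr => i _.
  have -> : ((x i 0)%:P + v i) ^+ be i =
    \sum_(a < D) ('C(be i, a)%:R * x i 0 ^+ (be i - a))%:P * v i ^+ a.
    rewrite exprDn (big_ord_widen D (fun a => (x i 0)%:P ^+ (be i - a) * v i ^+ a *+ 'C(be i, a)))//.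
    rewrite [RHS](bigID (fun a : 'I_D => (a < (be i).+1)%N)) /= [X in _ = _ + X]big1 => [|a].
      rewrite addr0; apply: eq_bigr => a _.
      by rewrite polyCM polyC_natr polyC_exp; ring.
    by rewrite -leqNgt => h; rewrite bin_small// mul0r polyC0 mul0r.
  over.
rewrite bigA_distr_bigA /=; apply: eq_bigr => f _.
rewrite big_split /= termX; congr (_ * _).
  by rewrite rmorph_prod; apply: eq_bigr => i _; rewrite mnmE.
by apply: eq_bigr => i _; rewrite mnmE.
Qed.

(** A functional with coefficients [[t^k] v^al] is evaluation along
    [x + v(t)] followed by extraction of the coefficient of degree [k]: this is
    Taylor's formula read in degree [k]. *)
Lemma dapply_coef (v : 'I_n -> {poly C}) (L h : {mpoly C[n]}) k :
  (forall al, L@_al = (mmap1 v al)`_k) ->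
  dapply x L h = (peval (fun i => (x i 0)%:P + v i) h)`_k.
Proof.
move=> hL.
have lin (al : 'X_{1..n}) : linear_for *%R (term al).
  by move=> c g g'; rewrite /term mderivmD mderivmZ mevalD mevalZ; ring.
have dE g : dapply x L g = \sum_(al <- msupp L) L@_al * term al g.
  by apply: eq_bigr => al _; rewrite mulrA.
elim/mpolyind: h => [|c be h _ _ ih].
  rewrite /peval mmap0 coef0 dE big1 // => al _.
  by rewrite /term raddf0 meval0 !mulr0.
rewrite dE; under eq_bigr do rewrite lin mulrDr mulrCA.
rewrite big_split /= -mulr_sumr -!dE ih /peval mmapD mmapZ coefD coefCM; congr (_ * _ + _).
(* A box that contains all the exponents dividing [be]. *)
pose D := (\max_i be i).+1.
have hD i : (be i < D)%N by rewrite ltnS leq_bigmax.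
rewrite dE -/(peval _ _) (peval_translate_monomial v hD) coef_sum.
pose G al := L@_al * term al 'X_[be].
under [RHS]eq_bigr do rewrite coefCM -hL mulrC -/(G _).
rewrite -(big_map (fun f : {ffun 'I_n -> 'I_D} => [multinom (f i : nat) | i < n]) xpredT G) /=.
apply: sum_uniq_support; first exact: msupp_uniq.
  rewrite map_inj_uniq ?index_enum_uniq// => f g /mnmP fg.
  by apply/ffunP => i; have := fg i; rewrite !mnmE => /val_inj.
move=> al; rewrite /G mulf_eq0 negb_or -mcoeff_msupp => /andP[-> tn0].
apply/esym/mapP.
have hal i : (al i < D)%N.
  apply: leq_ltn_trans (hD i); rewrite leqNgt; apply: contra tn0 => hlt.
  by rewrite termX (bigD1 i) //= bin_small// !mul0r.
exists [ffun i => Ordinal (hal i)]; first by rewrite mem_index_enum.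
by apply/mnmP => i; rewrite mnmE ffunE.
Qed.

Lemma mcoeff_Psi (s : 'I_n) (L : {mpoly C[n]}) al :
  (Psi s L)@_al =
  if [forall i : 'I_n, (i < s)%N ==> (al i == 0%N)] && (0 < al s)%N
  then L@_(al - U_(s))%MM else 0.
Proof.
rewrite /Psi raddf_sum /=.
case: ifP => [/andP[hz hs]|hn].
  have hU : (al - U_(s) + U_(s))%MM = al.
    by apply: submK; rewrite lep1mP -lt0n.
  have hz' : [forall i : 'I_n, (i < s)%N ==> ((al - U_(s))%MM i == 0%N)].
    apply/forallP => i; apply/implyP => si; rewrite mnmE.
    by have /forallP/(_ i)/implyP/(_ si)/eqP-> := hz.
  case: (boolP ((al - U_(s))%MM \in msupp L)) => hin; last first.
    rewrite (memN_msupp_eq0 hin) big_seq_cond big1 // => be /andP[hb _].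
    rewrite mcoeffZ mcoeffX; case: eqP => [e|]; last by rewrite mulr0.
    by move: hin; rewrite -e addmK hb.
  rewrite big_mkcond (bigD1_seq (al - U_(s))%MM) //=.
  rewrite hz' mcoeffZ mcoeffX hU eqxx mulr1 big1 ?addr0 // => be hne.
  case: ifP => // _; rewrite mcoeffZ mcoeffX; case: eqP => [e|]; last by rewrite mulr0.
  by move: hne; rewrite -e addmK eqxx.
rewrite big1 // => be hb; rewrite mcoeffZ mcoeffX.
case: eqP => [e|]; last by rewrite mulr0.
move: hn; rewrite -e !mnmE eqxx addn1 andbT => /negP[].
apply/forallP => i; apply/implyP => si; rewrite !mnmE.
have /forallP/(_ i)/implyP/(_ si)/eqP-> := hb.
by rewrite add0n eqb0 -val_eqE /= gtn_eqF.
Qed.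

(** [Psi t] multiplies by [d_t] the monomials free of [d_0, ..., d_(t-1)];
    hence a monomial comes only from the index of its first variable. *)
Lemma sum_Psi (G : 'I_n -> {mpoly C[n]}) (al : 'X_{1..n}) (s : 'I_n) :
  (forall i : 'I_n, (i < s)%N -> al i = 0%N) -> (0 < al s)%N ->
  (\sum_t Psi t (G t))@_al = (G s)@_(al - U_(s))%MM.
Proof.
move=> hz hs; rewrite raddf_sum (bigD1 s) //= mcoeff_Psi hs andbT ifT; last first.
  by apply/forallP => i; apply/implyP => /hz->.
rewrite big1 ?addr0 // => t ts; rewrite mcoeff_Psi; case: ifP => // /andP[ht h0].
have [lts|] := ltnP s t.
  by move/forallP: ht => /(_ s)/implyP/(_ lts)/eqP h; rewrite h in hs.
rewrite leq_eqVlt (inj_eq val_inj) (negPf ts)/= => /hz h.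
by rewrite h in h0.
Qed.

Lemma sum_Psi0 (G : 'I_n -> {mpoly C[n]}) : (\sum_t Psi t (G t))@_0%MM = 0.
Proof.
rewrite raddf_sum big1 // => t _; rewrite /= mcoeff_Psi mnm0E ltnn andbF //.
Qed.

Lemma mnm_min_support (al : 'X_{1..n}) : al <> 0%MM ->
  exists s : 'I_n, (forall i : 'I_n, (i < s)%N -> al i = 0%N) /\ (0 < al s)%N.
Proof.
move=> al0.
have [s0 hs0] : exists s : 'I_n, (0 < al s)%N.
  apply: contrapT => h; apply: al0; apply/mnmP => i; rewrite mnm0E.
  by apply/eqP; rewrite -leqn0 leqNgt; apply/negP => hi; apply: h; exists i.
case: (@arg_minnP _ s0 (fun s => (0 < al s)%N) (fun s : 'I_n => val s) hs0) => s hs hmin; exists s; split=> // i si.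
by apply/eqP; rewrite -leqn0 leqNgt; apply/negP => /hmin; rewrite leqNgt si.
Qed.

End Functionals.

Lemma mmap1_peel (A : comNzRingType) n (v : 'I_n -> A) (al : 'X_{1..n}) s : (0 < al s)%N ->
  mmap1 v al = v s * mmap1 v (al - U_(s))%MM.
Proof.
move=> hs; rewrite -{1}(@submK _ U_(s)%MM al) ?lep1mP -?lt0n//.
by rewrite commr_mmap1_M ?mmap1U 1?mulrC// => i m; apply: mulrC.
Qed.

Section MonomialRecursion.
Variables (A : comNzRingType) (n : nat) (v : 'I_n -> {poly A}).
Hypothesis v0 : forall s, (v s)`_0 = 0.

Lemma mmap1_coef0 (al : 'X_{1..n}) : (mmap1 v al)`_0 = (al == 0%MM)%:R.
Proof.
case: eqP => [->|/mnm_min_support[s [_ hs]]]; first by rewrite mmap11 coefC.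
by rewrite (mmap1_peel v hs) coef0M v0 mul0r.
Qed.

(** The recursion of the functionals, seen on one monomial: one factor
    [v_s] is taken off, where [s] is the first variable of the monomial.  The
    highest term of the convolution survives only for a monomial of degree one. *)
Lemma mmap1_coef_rec (al : 'X_{1..n}) (s : 'I_n) k :
  (0 < k)%N -> (0 < al s)%N ->
  (mmap1 v al)`_k =
  \sum_(j < k.-1) (v s)`_j.+1 * (mmap1 v (al - U_(s))%MM)`_(k.-1 - j)
  + (\sum_t (v t)`_k *: ('X_t : {mpoly A[n]}))@_al.
Proof.
case: k => // k _ hs; rewrite (mmap1_peel v hs) coefM big_ord_recl v0 mul0r add0r.
rewrite big_ord_recr /= subnn mmap1_coef0; congr (_ + _).
rewrite raddf_sum (bigD1 s) //= big1 ?addr0 => [|t ts].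
  rewrite mcoeffZ mcoeffX; congr (_ * (nat_of_bool _)%:R).
  apply/eqP/eqP => [h|<-]; last by apply/mnmP => i; rewrite !mnmE subnn.
  by rewrite -[RHS](@submK _ U_(s)%MM) ?lep1mP -?lt0n// h add0m.
rewrite mcoeffZ mcoeffX; case: eqP => [e|]; last by rewrite mulr0.
by move: hs; rewrite -e mnmE (negPf ts).
Qed.

End MonomialRecursion.

(** * The curve of the recursion *)

Section Curve.
Variables (R : realType) (m : nat).
Local Notation C := R[i].
Variables (F : polysys R m.+1) (x : 'cV[C]_m.+1).
Local Notation hist := (lambda_history F x).

Definition Lambda k := (nth (0, 0) (hist k) k.-1).1.
(** The vector [a_k] of the recursion. *)
Definition acoef k := (nth (0, 0) (hist k) k.-1).2.

Lemma size_hist k : size (hist k) = k.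
Proof. by elim: k => [|[|k] ih] //; rewrite [LHS]size_rcons ih. Qed.

Lemma histS k : hist k.+2 = rcons (hist k.+1)
  (let D := next_Delta (hist k.+1) in
   let ahat := - (invmx (jacobian_hat F x) *m
     \col_i dapply x D (F (lift ord_max i) 0)) in
   (D + \sum_(s < m) ahat s 0 *: 'X_(lift ord0 s), vcons 0 ahat)).
Proof. by []. Qed.

Lemma nth_hist j k : (j < k)%N -> nth (0, 0) (hist k) j = (Lambda j.+1, acoef j.+1).
Proof.
move=> /subnK <-; rewrite /Lambda /acoef -surjective_pairing.
elim: (k - j.+1)%N => [|d ih] //.
rewrite addSn addnS histS nth_rcons -addnS size_hist.
by rewrite leq_addl ih.
Qed.

Lemma next_Delta_hist k : next_Delta (hist k) =
  \sum_(s < m.+1) Psi s (\sum_(j < k) acoef j.+1 s 0 *: Lambda (k - j)).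
Proof.
rewrite /next_Delta; apply: eq_bigr => s _; congr (Psi _ _).
rewrite size_hist; apply: eq_bigr => j _; rewrite !nth_hist//; last first.
  by rewrite subnS prednK ?subn_gt0// leq_subr.
by rewrite /= -subSn // subSS.
Qed.

Lemma Delta_hist k : (1 < k)%N -> Delta F x k = next_Delta (hist k.-1).
Proof. by rewrite /Delta; case: k => [|[|k]]. Qed.

Lemma acoef1 : acoef 1 = delta_mx ord0 0. Proof. by []. Qed.

(** The last [m] entries of [a_k]. *)
Definition ahat k := - (invmx (jacobian_hat F x) *m
                     \col_i dapply x (Delta F x k) (F (lift ord_max i) 0)).

Lemma acoefE k : (1 < k)%N -> acoef k = vcons 0 (ahat k).
Proof.
case: k => [|[|k]] // _; rewrite /acoef histS nth_rcons size_hist ltnn eqxx.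
by rewrite /ahat Delta_hist.
Qed.

Lemma LambdaE k : (1 < k)%N ->
  Lambda k = Delta F x k + \sum_t acoef k t 0 *: 'X_t.
Proof.
move=> k1; rewrite acoefE //; move: k1; case: k => [|[|k]] // _.
rewrite /Lambda histS nth_rcons size_hist ltnn eqxx Delta_hist //=.
congr (_ + _); rewrite big_ord_recl mxE unlift_none scale0r add0r.
by apply: eq_bigr => s _; rewrite [in RHS]mxE liftK /ahat Delta_hist.
Qed.

Definition curve_disp K (s : 'I_m.+1) : {poly C} :=
  \poly_(j < K.+1) (if j == 0%N then 0 else acoef j s 0).

Definition curve K s : {poly C} := (x s 0)%:P + curve_disp K s.

Lemma coef0_curve_disp K s : (curve_disp K s)`_0 = 0.
Proof. by rewrite coef_poly. Qed.

Lemma coef_curve_disp K s k : (0 < k <= K)%N -> (curve_disp K s)`_k = acoef k s 0.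
Proof. by case: k => // k h; rewrite coef_poly ltnS -[(k.+1 <= K)%N]/((0 < k.+1 <= K)%N) h. Qed.

(** The recursion omits the linear functional carried by [a_k], so the
    sum over [t] compensates for it; that sum vanishes when the curve is
    truncated before degree [k]. *)
Lemma mcoeff_next_Delta k K : (0 < k)%N -> (k.-1 <= K)%N ->
  (forall j al, (0 < j < k)%N -> (Lambda j)@_al = (mmap1 (curve_disp K) al)`_j) ->
  forall al, (mmap1 (curve_disp K) al)`_k =
    (next_Delta (hist k.-1))@_al + (\sum_t (curve_disp K t)`_k *: 'X_t)@_al.
Proof.
move=> k0 kK ih al; rewrite next_Delta_hist.
case: (eqVneq al 0%MM) => [->|/eqP/mnm_min_support[s [hz hs]]].
  rewrite mmap11 coefC gtn_eqF// sum_Psi0 add0r raddf_sum big1 // => t _.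
  rewrite /= mcoeffZ mcoeffX; case: eqP => [/mnmP/(_ t)|]; last by rewrite mulr0.
  by rewrite !mnmE eqxx.
rewrite (mmap1_coef_rec (coef0_curve_disp K) k0 hs) (sum_Psi _ hz hs); congr (_ + _).
rewrite raddf_sum; apply: eq_bigr => j _; rewrite /= mcoeffZ coef_curve_disp; last first.
  by rewrite /= (leq_trans (ltn_ord j)).
rewrite ih //; apply/andP; split; first by rewrite subn_gt0.
by rewrite (leq_ltn_trans (leq_subr _ _))// prednK.
Qed.

(** Both sides satisfy the same recursion; the coefficients of the curve
    of degree above [k] do not enter, so any truncation [K >= k] serves. *)
Lemma mcoeff_Lambda k K al : (0 < k <= K)%N -> (Lambda k)@_al = (mmap1 (curve_disp K) al)`_k.
Proof.
have [N kN] := ubnP k; elim: N => // N ihN in k kN al * => /andP[k0 kK].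
rewrite (mcoeff_next_Delta k0 (leq_trans (leq_pred _) kK)); last first.
  move=> j be /andP[j0 jk]; apply: ihN; first exact: leq_trans jk _.
  by rewrite j0 (leq_trans (ltnW jk)).
under eq_bigr do rewrite coef_curve_disp ?k0//.
case: k k0 kK kN => [|[|k]] // _ kK kN; last by rewrite LambdaE // mcoeffD Delta_hist.
rewrite next_Delta_hist raddf_sum big1 => [|s _]; last first.
  by rewrite /= mcoeff_Psi; case: ifP => //; rewrite big_ord0 mcoeff0.
rewrite add0r raddf_sum (bigD1 ord0) //= big1 ?addr0 => [|s s0].
  by rewrite acoef1 mxE eqxx scale1r.
by rewrite acoef1 mxE (negPf s0) scale0r mcoeff0.
Qed.

Lemma mcoeff_Delta k al : (1 < k)%N -> (Delta F x k)@_al = (mmap1 (curve_disp k.-1) al)`_k.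
Proof.
move=> k1; rewrite Delta_hist // (mcoeff_next_Delta (ltnW k1) (leqnn _)).
  rewrite [X in _ = _ + X]raddf_sum [X in _ = _ + X]big1 ?addr0 // => t _.
  by rewrite /= coef_poly prednK ?ltnn ?scale0r ?mcoeff0// ltnW.
move=> j be /andP[j0 jk]; apply: mcoeff_Lambda; rewrite j0 /=.
by rewrite -ltnS prednK // ltnW.
Qed.

Lemma dapply_Delta k h : (1 < k)%N ->
  dapply x (Delta F x k) h = (peval (curve k.-1) h)`_k.
Proof. by move=> k1; apply: dapply_coef => al; apply: mcoeff_Delta. Qed.

Lemma coef0_curve K s : (curve K s)`_0 = x s 0.
Proof. by rewrite coefD coefC coef0_curve_disp addr0. Qed.

Lemma coef_curve K s k : (0 < k <= K)%N -> (curve K s)`_k = acoef k s 0.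
Proof.
by move=> hk; rewrite coefD coefC coef_curve_disp //; case: k hk => // k; rewrite add0r.
Qed.

Lemma curve_ord0 K : (0 < K)%N -> curve K ord0 = (x ord0 0)%:P + 'X.
Proof.
move=> K0; congr (_ + _); apply/polyP => -[|[|i]]; rewrite coefX.
- exact: coef0_curve_disp.
- by rewrite coef_curve_disp // acoef1 mxE.
have [iK|iK] := ltnP i.+1 K; last by rewrite coef_poly ltnS ltnNge iK.
by rewrite coef_curve_disp // acoefE // mxE unlift_none.
Qed.

Lemma coef1_peval_curve K h : (0 < K)%N ->
  (peval (curve K) h)`_1 = h^`M(ord0).@[fun j => x j 0].
Proof.
move=> K0; rewrite coef1_peval (bigD1 ord0) //= big1 ?addr0 => [|s s0].
  by rewrite coef_curve // acoef1 mxE eqxx mulr1; apply: meval_eq => j; apply: coef0_curve.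
by rewrite coef_curve // acoef1 mxE (negPf s0) mulr0.
Qed.

(** Extending the curve beyond degree [k - 1] changes the coefficient of
    degree [k] by the derivative of [h] in the direction [a_k]. *)
Lemma coef_peval_curve K h k : (1 < k <= K)%N ->
  (peval (curve K) h)`_k = dapply x (Delta F x k) h
   + \sum_(s < m) h^`M(lift ord0 s).@[fun j => x j 0] * ahat k s 0.
Proof.
case/andP=> k1 kK; rewrite dapply_Delta //.
pose E s := curve K s - curve k.-1 s.
have -> : curve K = fun l => curve k.-1 l + E l.
  by apply: funext => s; rewrite /E addrC subrK.
rewrite coef_peval_add; [congr (_ + _)|exact: ltnW|move=> l i ik].
  rewrite big_ord_recl /E coefB coef_curve ?acoefE ?(ltnW k1)//.
  rewrite mxE unlift_none [X in 0 - X]coefD coefC coef_poly prednK ?ltnn ?(ltnW k1)//.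
  rewrite (gtn_eqF (ltnW k1)) !addr0 subr0 mulr0 add0r; apply: eq_bigr => s _.
  rewrite coefB coef_curve ?acoefE ?(ltnW k1)//.
  rewrite mxE liftK [X in _ - X]coefD coefC coef_poly prednK ?ltnn ?(ltnW k1)//.
  rewrite (gtn_eqF (ltnW k1)) addr0 subr0; congr (_ * _); apply: meval_eq => j.
  exact: coef0_curve.
case: i ik => [|i] ik; first by rewrite coefB !coef0_curve subrr.
rewrite /E coefB !coef_curve ?subrr//=; first by rewrite -ltnS prednK // ltnW.
by rewrite (leq_trans (ltnW ik)).
Qed.

(** The vector [a_k] solves the linear equation that expresses this
    cancellation. *)
Lemma peval_hat_curve K i k : jacobian_hat F x \in unitmx -> (1 < k <= K)%N ->
  (peval (curve K) (F (lift ord_max i) 0))`_k = 0.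
Proof.
move=> hu hk; rewrite coef_peval_curve //.
have := congr1 (fun A : 'cV_m => A i 0) (mulKVmx hu
  (\col_i dapply x (Delta F x k) (F (lift ord_max i) 0))).
rewrite mxE [RHS]mxE => <-; rewrite -big_split /= big1 // => s _.
by rewrite /ahat !mxE mulrN addrN.
Qed.

(** The vectors [a_k] move only along directions in which the last
    equation has zero derivative, so [a_k] does not contribute to the coefficient
    of degree [k]. *)
Lemma peval_last_curve K k :
  (forall s : 'I_m, jacobian F x ord_max (lift ord0 s) = 0) -> (0 < k <= K)%N ->
  (peval (curve K) (F ord_max 0))`_k = dapply x (Delta F x k) (F ord_max 0).
Proof.
move=> hj; case: k => [|[|k]] // hk.
  rewrite coef1_peval_curve // /Delta eqxx /dapply msuppX big_seq1 mcoeffX eqxx mul1r.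
  rewrite mderivmU1m big1 ?invr1 ?mul1r // => s _.
  by rewrite mnmE; case: eqP.
rewrite coef_peval_curve // big1 ?addr0 // => s _.
by have := hj s; rewrite mxE => ->; rewrite mul0r.
Qed.

End Curve.

Local Open Scope sesquilinear_scope.

(** * Singular value decompositions near a matrix of corank one *)

Section Unitary.
Variables (R : realType) (n : nat).
Local Notation C := R[i].
Implicit Types U V W : 'M[C]_n.

Lemma adjE p q (A : 'M[C]_(p, q)) i j : (A ^t*) i j = (A j i)^*.
Proof. by rewrite !mxE. Qed.

Lemma unitary_mulC U : U \is unitarymx -> U *m U ^t* = 1%:M.
Proof. by move/unitarymxP. Qed.

Lemma unitary_Cmul U : U \is unitarymx -> U ^t* *m U = 1%:M.
Proof. by move/unitarymxP/mulmx1C. Qed.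

Lemma adj_mul p q r (A : 'M[C]_(p, q)) (B : 'M[C]_(q, r)) :
  (A *m B) ^t* = B ^t* *m A ^t*.
Proof. by rewrite trmx_mul map_mxM. Qed.

Lemma adjK p q (A : 'M[C]_(p, q)) : A ^t* ^t* = A.
Proof. by apply/matrixP => i j; rewrite !adjE conjCK. Qed.

Lemma unitary_prod U V : U \is unitarymx -> V \is unitarymx -> U *m V \is unitarymx.
Proof. exact: mul_unitarymx. Qed.

Lemma unitary_adj U : U \is unitarymx -> U ^t* \is unitarymx.
Proof. by move=> hU; apply/unitarymxP; rewrite adjK unitary_Cmul. Qed.

Lemma unitary_row U i j : U \is unitarymx ->
  \sum_k U i k * (U j k)^* = (i == j)%:R.
Proof.
move/unitary_mulC/matrixP/(_ i j); rewrite !mxE => <-.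
by apply: eq_bigr => k _; rewrite adjE.
Qed.

Lemma unitary_col U i j : U \is unitarymx ->
  \sum_k (U k i)^* * U k j = (i == j)%:R.
Proof.
move/unitary_Cmul/matrixP/(_ i j); rewrite !mxE => <-.
by apply: eq_bigr => k _; rewrite adjE.
Qed.

Lemma unitary_row1 U i : U \is unitarymx -> \sum_k U i k * (U i k)^* = 1.
Proof. by move/(unitary_row i i) => ->; rewrite eqxx. Qed.

Lemma unitary_col1 U j : U \is unitarymx -> \sum_k (U k j)^* * U k j = 1.
Proof. by move/(unitary_col j j) => ->; rewrite eqxx. Qed.

Lemma unitary_cabs_le1 U i j : U \is unitarymx -> cabs (U i j) <= 1.
Proof.
move=> hU; have := unitary_row1 i hU; rewrite (bigD1 j)//= => h.
have h1 : `|U i j| ^+ 2 <= 1.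
  rewrite -h normCK lerDl; apply: sumr_ge0 => k _; exact: mul_conjC_ge0.
by rewrite -lecR cabsE rmorph1 -(expr_le1 (n := 2)).
Qed.

End Unitary.

Section MatrixFamilies.
Variables (R : realType) (P : Type) (eps : P -> R).
Local Notation C := R[i].
Local Notation bigO := (bigO eps).
Local Notation away := (away eps).

Definition mbigO k a b (A : P -> 'M[C]_(a, b)) :=
  forall i j, bigO k (fun p => A p i j).

Lemma mbigO_ext k a b (A B : P -> 'M[C]_(a, b)) :
  (forall p, A p = B p) -> mbigO k B -> mbigO k A.
Proof. by move=> e h i j; apply: bigO_ext (h i j) => p; rewrite e. Qed.

Lemma mbigOM j k a b c (A : P -> 'M[C]_(a, b)) (B : P -> 'M[C]_(b, c)) :
  mbigO j A -> mbigO k B -> mbigO (j + k) (fun p => A p *m B p).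
Proof.
move=> hA hB r s; apply: bigO_bigsum (fun p => mxE _ _ _ _) _ => t.
exact: bigOM.
Qed.

Lemma mbigOMl k a b c (A : P -> 'M[C]_(a, b)) (B : P -> 'M[C]_(b, c)) :
  mbigO 0 A -> mbigO k B -> mbigO k (fun p => A p *m B p).
Proof. exact: mbigOM. Qed.

Lemma mbigOMr k a b c (A : P -> 'M[C]_(a, b)) (B : P -> 'M[C]_(b, c)) :
  mbigO k A -> mbigO 0 B -> mbigO k (fun p => A p *m B p).
Proof. by move=> hA hB; rewrite -[k]addn0; apply: mbigOM. Qed.

Lemma mbigOD k a b (A B : P -> 'M[C]_(a, b)) :
  mbigO k A -> mbigO k B -> mbigO k (fun p => A p + B p).
Proof.
by move=> hA hB i j; apply: bigO_ext (bigOD (hA i j) (hB i j)) => p; rewrite mxE.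
Qed.

Lemma mbigON k a b (A : P -> 'M[C]_(a, b)) : mbigO k A -> mbigO k (fun p => - A p).
Proof. by move=> hA i j; apply: bigO_ext (bigON (hA i j)) => p; rewrite mxE. Qed.

Lemma mbigO_adj k a b (A : P -> 'M[C]_(a, b)) : mbigO k A -> mbigO k (fun p => A p ^t*).
Proof. by move=> hA i j; apply: bigO_ext (bigO_conj (hA j i)) => p; rewrite adjE. Qed.

Lemma mbigO_cst a b (A : 'M[C]_(a, b)) : mbigO 0 (fun=> A).
Proof. by move=> i j; apply: bigO_cst. Qed.

Lemma mbigO_unitary n (U : P -> 'M[C]_n) : (forall p, U p \is unitarymx) -> mbigO 0 U.
Proof. by move=> hU i j; apply: bigO_bound => p; apply: unitary_cabs_le1. Qed.

(** A unitary matrix whose last column is almost concentrated on the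
    diagonal has the same property for its last row, by orthogonality of the
    columns. *)
Lemma unitary_last_column n (U : P -> 'M[C]_n.+1) :
  (forall p, U p \is unitarymx) ->
  (forall i, i != ord_max -> bigO 1 (fun p => U p i ord_max)) ->
  away (fun p => U p ord_max ord_max) /\
  forall j, j != ord_max -> bigO 1 (fun p => U p ord_max j).
Proof.
move=> hU hcol; have bU := mbigO_unitary hU.
have aL : away (fun p => U p ord_max ord_max).
  apply: (away_factor (x := fun p => (U p ord_max ord_max)^* )).
    exact: bigO_conj.
  apply: away_perturb (away_cst eps (oner_neq0 C)) _.
  apply: (bigO_ext (y := fun p => - \sum_(k | k != ord_max)
      (U p k ord_max)^* * U p k ord_max)).
    move=> p; have := unitary_col1 ord_max (hU p).
    by rewrite (bigD1 ord_max)//= => <-; ring.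
  apply/bigON/bigO_sum => k /hcol hk.
  by apply: bigOMl => //; apply: bigO_conj.
split=> // j jL; apply: (bigO_cancel (x := fun p => (U p ord_max ord_max)^* )).
  have [c c0 h] := aL; exists c => //.
  by apply: near0W h => p; rewrite cabs_conj.
apply: (bigO_ext (y := fun p => - \sum_(k | k != ord_max)
    (U p k ord_max)^* * U p k j)).
  move=> p; have := unitary_col ord_max j (hU p).
  rewrite eq_sym (negPf jL) (bigD1 ord_max)//= => /eqP.
  by rewrite addr_eq0 => /eqP.
apply/bigON/bigO_sum => k /hcol hk.
by apply: bigOMr => //; apply: bigO_conj.
Qed.

Section Svd.
Variable n : nat.
Variables (M0 U0 V0 : 'M[C]_n.+1) (S0 : 'rV[R]_n.+1).
Hypothesis svd0 : is_svd M0 U0 S0 V0.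
Hypothesis S0_last : S0 0 ord_max = 0.
Hypothesis S0_neq0 : forall i, i != ord_max -> S0 0 i != 0.
Variables (M U V : P -> 'M[C]_n.+1) (S : P -> 'rV[R]_n.+1).
Hypothesis svdM : forall p, is_svd (M p) (U p) (S p) (V p).
Hypothesis M_near : mbigO 1 (fun p => M p - M0).

Local Notation T p := (U0 ^t* *m U p).
Local Notation Phi p := (V0 ^t* *m V p).
Local Notation s p j := ((S p 0 j)%:C%C).
Local Notation s0 j := ((S0 0 j)%:C%C).

Lemma svd_unitaryT p : T p \is unitarymx.
Proof.
case: svd0 => h0 _ _ _ _; case: (svdM p) => h _ _ _ _.
exact: unitary_prod (unitary_adj h0) h.
Qed.

Lemma svd_unitaryPhi p : Phi p \is unitarymx.
Proof.
case: svd0 => _ h0 _ _ _; case: (svdM p) => _ h _ _ _.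
exact: unitary_prod (unitary_adj h0) h.
Qed.

Let bU : mbigO 0 U.
Proof. by apply: mbigO_unitary => p; case: (svdM p). Qed.

Let bV : mbigO 0 V.
Proof. by apply: mbigO_unitary => p; case: (svdM p). Qed.

Let bT : mbigO 0 (fun p => T p). Proof. exact: mbigO_unitary svd_unitaryT. Qed.
Let bPhi : mbigO 0 (fun p => Phi p). Proof. exact: mbigO_unitary svd_unitaryPhi. Qed.

(** From [M V = U S] and [M0 = U0 S0 V0^*], the matrices [T = U0^* U] and
    [Phi = V0^* V] almost intertwine [S] and [S0]. *)
Lemma svd_compare_right i j : bigO 1 (fun p => T p i j * s p j - s0 i * Phi p i j).
Proof.
have h : mbigO 1 (fun p => U0 ^t* *m (M p - M0) *m V p).
  by apply: mbigOMr => //; apply: mbigOMl => //; apply: mbigO_cst.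
apply: bigO_ext (h i j) => p.
have [_ vp _ _ ->] := svdM p; have [u0 _ _ _ ->] := svd0.
rewrite mulmxBr mulmxBl -!mulmxA (unitary_Cmul vp) mulmx1.
rewrite !(mulmxA (U0 ^t*)) (unitary_Cmul u0) mul1mx [in RHS]mxE; congr (_ + _).
  by rewrite mul_mx_diag !mxE.
by rewrite mul_diag_mx !mxE.
Qed.

Lemma svd_compare_left i j :
  bigO 1 (fun p => s p i * (Phi p j i)^* - (T p j i)^* * s0 j).
Proof.
have h : mbigO 1 (fun p => U p ^t* *m (M p - M0) *m V0).
  apply: mbigOMr; last exact: mbigO_cst.
  by apply: mbigOMl => //; apply: mbigO_adj.
apply: bigO_ext (h i j) => p.
have [up _ _ _ ->] := svdM p; have [_ v0 _ _ ->] := svd0.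
rewrite mulmxBr mulmxBl -!mulmxA (unitary_Cmul v0) mulmx1.
rewrite !(mulmxA (U p ^t*)) (unitary_Cmul up) mul1mx [in RHS]mxE; congr (_ + _).
  by rewrite mul_diag_mx [in RHS]mxE -adjE adj_mul adjK; congr (_ * _); rewrite mxE.
rewrite [RHS]mxE; congr (- _); rewrite mul_mx_diag [RHS]mxE -adjE adj_mul adjK.
by congr (_ * _); rewrite mxE.
Qed.

(** The last singular value is the smallest, hence bounded by the mean of
    the singular values with the weights [|Phi_Lj|^2], where [L] is the last
    index; each [s_j Phi_Lj] is [O(eps)] because [S0] vanishes at [L]. *)
Lemma svd_last_small : bigO 1 (fun p => s p ord_max).
Proof.
pose y p := \sum_i s p i * (Phi p ord_max i)^* * Phi p ord_max i.
have hy : bigO 1 y.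
  apply: bigO_sum => i _; apply: bigOMr => //.
  apply: bigO_ext (svd_compare_left i ord_max) => p.
  by rewrite S0_last mulr0 subr0.
apply: bigO_le_cabs hy; apply: near0T => p.
have [_ _ pos srt _] := svdM p.
rewrite -lecR !cabsE.
have sp0 : 0 <= s p ord_max by rewrite (@lecR _ 0) pos.
rewrite ger0_norm //.
have -> : s p ord_max = \sum_i s p ord_max * (Phi p ord_max i * (Phi p ord_max i)^* ).
  by rewrite -mulr_sumr (unitary_row1 _ (svd_unitaryPhi p)) mulr1.
rewrite [X in _ <= X]ger0_norm; last first.
  apply: sumr_ge0 => i _; rewrite -mulrA mulr_ge0 ?(@lecR _ 0)//.
  by rewrite mulrC mul_conjC_ge0.
apply: ler_sum => i _; rewrite -mulrA ler_pM ?mul_conjC_ge0//.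
  by rewrite lecR srt // -ltnS.
by rewrite mulrC.
Qed.

Lemma svd_Phi_col i : i != ord_max -> bigO 1 (fun p => Phi p i ord_max).
Proof.
move=> iL; apply: (bigO_cancel (x := fun=> s0 i)).
  by apply: away_cst; rewrite (inj_eq (@complexI _)) S0_neq0.
have h := bigOMl (bT i ord_max) svd_last_small.
by apply: bigO_ext (bigOB h (svd_compare_right i ord_max)) => p; ring.
Qed.

Lemma svd_T_col i : i != ord_max -> bigO 1 (fun p => T p i ord_max).
Proof.
move=> iL; have h : bigO 1 (fun p => (T p i ord_max)^* ).
  apply: (bigO_cancel (x := fun=> s0 i)).
    by apply: away_cst; rewrite (inj_eq (@complexI _)) S0_neq0.
  have h := bigOMr svd_last_small (bigO_conj (bPhi i ord_max)).
  by apply: bigO_ext (bigOB h (svd_compare_left ord_max i)) => p; ring.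
by apply: bigO_ext (bigO_conj h) => p; rewrite conjCK.
Qed.

Lemma svd_T_last : away (fun p => T p ord_max ord_max).
Proof. by have [] := unitary_last_column svd_unitaryT svd_T_col. Qed.

Lemma svd_Phi_last : away (fun p => Phi p ord_max ord_max).
Proof. by have [] := unitary_last_column svd_unitaryPhi svd_Phi_col. Qed.

Lemma svd_Phi_row j : j != ord_max -> bigO 1 (fun p => Phi p ord_max j).
Proof. by have [_] := unitary_last_column svd_unitaryPhi svd_Phi_col; apply. Qed.

(** Column [j] of [Phi] has norm one and an [O(eps)] entry in the last row,
    so its other entries, which are [s_j T_ij / s0_i] up to [O(eps)], cannot all
    be small. *)
Lemma svd_away j : j != ord_max -> away (fun p => s p j).
Proof.
(* [X p * s_j] is the squared norm of column [j] of [Phi] up to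
     [O(eps)] and without its last entry. *)
move=> jL; pose X p := \sum_(i | i != ord_max) (s0 i)^-1 * (Phi p i j)^* * T p i j.
have bX : bigO 0 X.
  apply: bigO_sum => i _; apply: bigOMl => //.
  by apply: bigOMl; [apply: bigO_cst|apply: bigO_conj].
apply: (away_factor (x := X)) => //.
apply: away_perturb (away_cst eps (oner_neq0 C)) _.
apply: (bigO_ext (y := fun p => \sum_(i | i != ord_max)
   (s0 i)^-1 * (Phi p i j)^* * (T p i j * s p j - s0 i * Phi p i j)
   - (Phi p ord_max j)^* * Phi p ord_max j)).
  move=> p; rewrite -(unitary_col1 j (svd_unitaryPhi p)) (bigD1 ord_max) //= opprD addrA addrAC.
  congr (_ - _); rewrite mulr_suml -sumrB; apply: eq_bigr => i iL.
  have si : s0 i != 0 by rewrite (inj_eq (@complexI _)) S0_neq0.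
  by rewrite mulrBr; congr (_ - _); [ring|field].
apply: bigOB.
  apply: bigO_sum => i _; apply: bigOMl (svd_compare_right _ _).
  by apply: bigOMl; [apply: bigO_cst|apply: bigO_conj].
by apply: bigOMl (svd_Phi_row jL); apply: bigO_conj.
Qed.

End Svd.
End MatrixFamilies.

Section Corank.
Variables (R : realType) (n : nat).
Local Notation C := R[i].

(** Two vanishing singular values would give two orthogonal vectors in the
    kernel. *)
Lemma svd_corank1 (A U V : 'M[C]_n.+1) (S : 'rV[R]_n.+1) :
  is_svd A U S V -> S 0 ord_max = 0 -> \rank (kermx A^T) = 1%N ->
  forall i, i != ord_max -> S 0 i != 0.
Proof.
move=> [_ hV _ _ hA] SL rk i iL; apply/eqP => Si.
have ker j : S 0 j = 0 -> ((col j V)^T <= kermx A^T)%MS.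
  move=> Sj; apply/sub_kermxP; rewrite -trmx_mul hA colE mulmxA.
  rewrite -(mulmxA _ _ V) unitary_Cmul // mulmx1 -colE mul_mx_diag; apply/matrixP => a b.
  by rewrite !mxE Sj mulr0.
have nz : (col ord_max V)^T != 0.
  apply/eqP => /matrixP h; have := unitary_col1 ord_max hV.
  rewrite big1 => [/eqP|k _]; first by rewrite eq_sym oner_eq0.
  by have := h 0 k; rewrite !mxE => ->; rewrite mulr0.
have /mxrank_leqif_eq [_] := ker _ SL.
rewrite rk rank_rV nz eqxx => /esym eqK.
have : ((col i V)^T <= (col ord_max V)^T)%MS.
  by apply: submx_trans (ker i Si) _; case/andP: eqK.
case/sub_rVP => c /matrixP h.
have c0 : c = 0.
  suff <- : \sum_k (V k ord_max)^* * V k i = c.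
    by rewrite (unitary_col _ _ hV) eq_sym (negPf iL).
  rewrite -[RHS]mulr1 -(unitary_col1 ord_max hV) mulr_sumr; apply: eq_bigr => k _.
  by have := h 0 k; rewrite !mxE => ->; ring.
have := unitary_col1 i hV; rewrite big1 => [/eqP|k _].
  by rewrite eq_sym oner_eq0.
by have := h 0 k; rewrite !mxE c0 mul0r => ->; rewrite mulr0.
Qed.

End Corank.

(** * Unitary changes of coordinates *)

Section Change.
Variables (R : realType).
Local Notation C := R[i].

Definition mulpoly a b (W : 'M[C]_(a, b)) (X : 'I_b -> {poly C}) : 'I_a -> {poly C} :=
  fun k => \sum_l (W k l)%:P * X l.

Lemma mulpolyA a b c (W : 'M[C]_(a, b)) (W' : 'M[C]_(b, c)) X :
  mulpoly W (mulpoly W' X) = mulpoly (W *m W') X.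
Proof.
apply: funext => k; rewrite /mulpoly; under eq_bigr do rewrite mulr_sumr.
rewrite exchange_big; apply: eq_bigr => l _; rewrite mxE rmorph_sum mulr_suml.
by apply: eq_bigr => j _; rewrite /= polyCM mulrA.
Qed.

Lemma coef_mulpoly a b (W : 'M[C]_(a, b)) X k i :
  (mulpoly W X k)`_i = \sum_l W k l * (X l)`_i.
Proof. by rewrite coef_sum; apply: eq_bigr => l _; rewrite coefCM. Qed.

Lemma mulpoly1 a (X : 'I_a -> {poly C}) : mulpoly 1%:M X = X.
Proof.
apply: funext => k; rewrite /mulpoly (bigD1 k)//= big1 => [|l lk].
  by rewrite mxE eqxx mul1r addr0.
by rewrite mxE eq_sym (negPf lk) mul0r.
Qed.

Variable n : nat.
Implicit Types (f g : polysys R n) (U W : 'M[C]_n).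

Definition peval_sys f (X : 'I_n -> {poly C}) : 'I_n -> {poly C} :=
  fun i => peval X (f i 0).

(** Evaluation on polynomial curves, instead of on points, so that values,
    Jacobians and coefficients along curves all follow from this one identity. *)
Definition is_change U W f g :=
  forall X, peval_sys g X = mulpoly (U ^t*) (peval_sys f (mulpoly W X)).

Lemma unitary_change_is_change U W f : is_change U W f (unitary_change U W f).
Proof.
move=> X; apply: funext => i; rewrite /peval_sys /peval /mulpoly mxE rmorph_sum.
apply: eq_bigr => l _; rewrite rmorphM 2!mxE; congr (_ * _); first by rewrite /= mmapC.
rewrite mxE /=.
elim/mpoly_ring_ind: (f l 0) => [c|k|g h hg hh|g h hg hh].
- by rewrite comp_mpolyC !mmapC.
- rewrite comp_mpolyXU mmapX mmap1U -tnth_nth tnth_mktuple rmorph_sum.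
  by apply: eq_bigr => j _; rewrite /= mmapZ mmapX mmap1U.
- by rewrite comp_mpolyD mmapD [RHS]mmapD; congr (_ + _); [exact: hg|exact: hh].
- by rewrite [comp_mpoly _ _]rmorphM !rmorphM /=; congr (_ * _); [exact: hg|exact: hh].
Qed.

Lemma is_change_comp U U' W W' f g h :
  is_change U W f g -> is_change U' W' g h -> is_change (U *m U') (W *m W') f h.
Proof. by move=> hg hh X; rewrite hh hg !mulpolyA adj_mul. Qed.

Lemma seval_coef0 f (x : 'cV[C]_n) (X : 'I_n -> {poly C}) i :
  (forall l, (X l)`_0 = x l 0) -> (peval_sys f X i)`_0 = seval f x i 0.
Proof. by move=> hX; rewrite /peval_sys coef0_peval mxE; apply: meval_eq. Qed.

Lemma is_change_seval U W f g x : is_change U W f g ->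
  seval g x = U ^t* *m seval f (W *m x).
Proof.
move=> hg; apply/matrixP => i j; rewrite ord1 {j} [RHS]mxE.
rewrite -(@seval_coef0 g x (fun l => (x l 0)%:P)) => [|l]; last by rewrite coefC.
rewrite hg coef_mulpoly; apply: eq_bigr => l _; congr (_ * _); apply: seval_coef0 => k.
by rewrite coef_mulpoly mxE; apply: eq_bigr => s _; rewrite coefC.
Qed.

Lemma jacobian_coef1 f (x : 'cV[C]_n) (X : 'I_n -> {poly C}) i :
  (forall l, (X l)`_0 = x l 0) ->
  (peval_sys f X i)`_1 = \sum_l jacobian f x i l * (X l)`_1.
Proof.
move=> hX; rewrite /peval_sys coef1_peval; apply: eq_bigr => l _; rewrite mxE.
by congr (_ * _); apply: meval_eq.
Qed.

(** The chain rule, read off as the coefficient of degree one along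
    straight lines. *)
Lemma is_change_jacobian U W f g x : is_change U W f g ->
  jacobian g x = U ^t* *m jacobian f (W *m x) *m W.
Proof.
move=> hg; apply/matrixP => i j.
(* The line through [x] in the direction of coordinate [j]. *)
pose X l : {poly C} := (x l 0)%:P + (l == j)%:R *: 'X.
have x0 l : (X l)`_0 = x l 0 by rewrite coefD coefC coefZ coefX mulr0 addr0.
have X1 l : (X l)`_1 = (l == j)%:R by rewrite coefD coefC coefZ coefX mulr1 add0r.
have -> : jacobian g x i j = (peval_sys g X i)`_1.
  rewrite (jacobian_coef1 g i x0) (bigD1 j)//= big1 => [|l lj].
    by rewrite X1 eqxx mulr1 addr0.
  by rewrite X1 (negPf lj) mulr0.
rewrite hg coef_mulpoly -mulmxA [RHS]mxE; apply: eq_bigr => l _; congr (_ * _).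
rewrite (@jacobian_coef1 f (W *m x)) => [|k]; last first.
  by rewrite coef_mulpoly mxE; apply: eq_bigr => s _; rewrite x0.
rewrite mxE; apply: eq_bigr => k _; congr (_ * _); rewrite coef_mulpoly.
rewrite (bigD1 j)//= big1 => [|s sj]; first by rewrite X1 eqxx mulr1 addr0.
by rewrite X1 (negPf sj) mulr0.
Qed.

End Change.

Section Rotation.
Variables (R : realType) (m : nat).
Local Notation C := R[i].

Lemma ord_pred0 : ord_pred (ord0 : 'I_m.+1) = ord_max.
Proof. by apply: val_inj; rewrite /= modn_small. Qed.

Lemma ord_pred_lift (s : 'I_m) : ord_pred (lift ord0 s) = lift ord_max s.
Proof.
apply: val_inj; rewrite /= [in RHS]/bump leqNgt ltn_ord add0n.
by rewrite modnDr modn_small // ltnW // ltnS.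
Qed.

Lemma ord_pred_inj : injective (@ord_pred m.+1).
Proof. exact: can_inj (@ord_predK _). Qed.

Lemma lift_max_neq (s : 'I_m) : lift ord_max s != ord_max :> 'I_m.+1.
Proof. by rewrite eq_sym neq_lift. Qed.

Lemma lift_maxP (i : 'I_m.+1) : i != ord_max -> exists s : 'I_m, i = lift ord_max s.
Proof. by rewrite eq_sym => /unlift_some[s -> _]; exists s. Qed.

Lemma rotcolsE (V : 'M[C]_m.+1) i j : rotcols V i j = V i (ord_pred j).
Proof. by rewrite mxE. Qed.

Lemma rotcols_mul (W V : 'M[C]_m.+1) : rotcols (W *m V) = W *m rotcols V.
Proof. by apply/matrixP => i j; rewrite !mxE; apply: eq_bigr => k _; rewrite mxE. Qed.

Lemma rotcols_adj_mul (V : 'M[C]_m.+1) q (A : 'M[C]_(m.+1, q)) i j :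
  ((rotcols V) ^t* *m A) i j = (V ^t* *m A) (ord_pred i) j.
Proof. by rewrite !mxE; apply: eq_bigr => k _; rewrite !adjE rotcolsE. Qed.

Lemma rotcols_unitary (V : 'M[C]_m.+1) : V \is unitarymx -> rotcols V \is unitarymx.
Proof.
move=> hV; apply/unitarymxP/mulmx1C/matrixP => i j.
by rewrite rotcols_adj_mul -rotcols_mul unitary_Cmul // !mxE (inj_eq ord_pred_inj).
Qed.

(** In the coordinates of a singular value decomposition the Jacobian is
    the diagonal matrix of singular values with its columns rotated by one place. *)
Lemma svd_change_jacobian (f g : polysys R m.+1) zeta A B S w :
  is_svd (jacobian f zeta) A S B -> is_change A (rotcols B) f g ->
  w = (rotcols B) ^t* *m zeta ->
  forall i j, jacobian g w i j = (S 0 i)%:C%C * (i == ord_pred j)%:R.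
Proof.
move=> [hA hB _ _ hf] hg -> i j; rewrite (is_change_jacobian _ hg) mulmxA.
rewrite (unitary_mulC (rotcols_unitary hB)) mul1mx hf -!mulmxA (mulmxA (A ^t*)).
rewrite (unitary_Cmul hA) mul1mx -rotcols_mul (unitary_Cmul hB) mul_diag_mx.
by rewrite !mxE.
Qed.

Lemma svd_change_jacobian_hat (f g : polysys R m.+1) zeta A B S w :
  is_svd (jacobian f zeta) A S B -> is_change A (rotcols B) f g ->
  w = (rotcols B) ^t* *m zeta ->
  jacobian_hat g w = diag_mx (\row_t (S 0 (lift ord_max t))%:C%C).
Proof.
move=> hs hg hw; apply/matrixP => a b; rewrite mxE (svd_change_jacobian hs hg hw).
by rewrite ord_pred_lift (inj_eq lift_inj) !mxE; case: eqP; rewrite ?mulr1 ?mulr0.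
Qed.

Lemma diag_mx_unit (d : 'rV[C]_m) : (forall t, d 0 t != 0) -> diag_mx d \in unitmx.
Proof. by move=> h; rewrite unitmxE det_diag unitfE; apply/prodf_neq0 => t _. Qed.

End Rotation.

(** * Expansions at a nearby point and translated curves *)

Section NumericTaylor.
Variables (R : realType) (P : Type) (eps : P -> R) (n : nat).
Local Notation C := R[i].
Local Notation bigO := (bigO eps).
Local Notation mbigO := (mbigO eps).
Variables (zeta : P -> 'cV[C]_n) (xi : 'cV[C]_n).
Hypothesis near_xi : mbigO 1 (fun p => zeta p - xi).

Lemma near_bounded : mbigO 0 zeta.
Proof.
have h : mbigO 0 (fun p => zeta p - xi) by move=> i j; apply: bigOW (near_xi i j).
by apply: mbigO_ext (mbigOD h (mbigO_cst eps xi)) => p; rewrite subrK.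
Qed.

Lemma meval_taylor (h : {mpoly C[n]}) :
  bigO 2 (fun p => h.@[fun j => xi j 0] - h.@[fun j => zeta p j 0]
    - \sum_i h^`M(i).@[fun j => zeta p j 0] * (xi - zeta p) i 0).
Proof.
have e1 i : bigO 1 (fun p => (xi - zeta p) i 0).
  by apply: bigO_ext (bigON (near_xi i 0)) => p; rewrite !mxE opprB.
have := @family_taylor C C idfun P n (bigO 0) (bigO 2) (bigO_cst eps)
  (@bigOD _ _ eps 0) (@bigOMl _ _ eps 0) (bigO0 eps 2) (@bigOD _ _ eps 2)
  (@bigOMl _ _ eps 2) (fun p i => zeta p i 0) (fun p i => (xi - zeta p) i 0)
  (fun i => near_bounded i 0) (fun i => bigOW (leq0n 1) (e1 i))
  (fun i j => bigOM (e1 i) (e1 j)) h.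
apply: bigO_ext => p; congr (_ - _ - _); apply: meval_eq => i.
by rewrite !mxE; ring.
Qed.

Lemma meval_continuous (h : {mpoly C[n]}) :
  bigO 1 (fun p => h.@[fun j => zeta p j 0] - h.@[fun j => xi j 0]).
Proof.
have bd g : bigO 0 (fun p => g.@[fun j => zeta p j 0]).
  exact: (@family_eval C C idfun P n (bigO 0) (bigO_cst eps)
    (@bigOD _ _ eps 0) (@bigOMl _ _ eps 0) (fun p i => zeta p i 0)
    (fun i => near_bounded i 0) g).
have h2 := bigOW (leqnSn 1) (meval_taylor h).
have h1 : bigO 1 (fun p => \sum_i h^`M(i).@[fun j => zeta p j 0] * (zeta p - xi) i 0).
  by apply: bigO_sum => i _; apply: bigOMl (bd _) (near_xi i 0).
apply: bigO_ext (bigOB h1 h2) => p.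
have -> : \sum_i h^`M(i).@[fun j => zeta p j 0] * (xi - zeta p) i 0 =
   - \sum_i h^`M(i).@[fun j => zeta p j 0] * (zeta p - xi) i 0.
  by rewrite -sumrN; apply: eq_bigr => i _; rewrite !mxE; ring.
by ring.
Qed.

Lemma jacobian_continuous (f : polysys R n) :
  mbigO 1 (fun p => jacobian f (zeta p) - jacobian f xi).
Proof.
by move=> i j; apply: bigO_ext (meval_continuous (f i 0)^`M(j)) => p; rewrite !mxE.
Qed.

Lemma jacobian_bounded (f : polysys R n) : mbigO 0 (fun p => jacobian f (zeta p)).
Proof.
have h : mbigO 0 (fun p => jacobian f (zeta p) - jacobian f xi).
  by move=> i j; apply: bigOW (jacobian_continuous f i j).
by apply: mbigO_ext (mbigOD h (mbigO_cst eps (jacobian f xi))) => p; rewrite subrK.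
Qed.

(** The expansion is made at [zeta], where the singular value decomposition
    is known, and evaluated at [xi], where [f] vanishes. *)
Lemma seval_taylor (f : polysys R n) : seval f xi = 0 ->
  mbigO 2 (fun p => seval f (zeta p) - jacobian f (zeta p) *m (zeta p - xi)).
Proof.
move=> f0 i j; apply: bigO_ext (bigON (meval_taylor (f i 0))) => p.
have fi : (f i 0).@[fun j => xi j 0] = 0.
  by have /matrixP/(_ i 0) := f0; rewrite !mxE.
rewrite fi (_ : \sum_k _ =
  - \sum_k jacobian f (zeta p) i k * (zeta p - xi) k 0).
  by rewrite ord1 mxE [X in X + _]mxE [X in _ + X]mxE [X in _ - X]mxE; ring.
by rewrite -sumrN; apply: eq_bigr => k _; rewrite !mxE; ring.
Qed.

End NumericTaylor.

Section Shift.
Variables (R : realType) (P : Type) (eps : P -> R).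
Local Notation C := R[i].
Local Notation bigO := (bigO eps).
Local Notation pbounded := (pbounded eps).

Lemma coef_XaddC_exp (t : C) j k :
  (('X + t%:P) ^+ j)`_k = t ^+ (j - k) *+ 'C(j, k).
Proof.
rewrite exprDn coef_sum.
under eq_bigr => i _ do rewrite coefMn mulrC -polyC_exp coefCM coefXn.
have [kj|jk] := leqP k j; last first.
  rewrite bin_small // big1 // => i _; rewrite gtn_eqF ?mulr0 ?mul0rn //.
  by rewrite (leq_ltn_trans (leq_subr _ _)).
have hi : (j - k < j.+1)%N by rewrite ltnS leq_subr.
rewrite (bigD1 (Ordinal hi)) //= subKn // eqxx mulr1 bin_sub // big1 ?addr0 // => i.
rewrite -val_eqE /= => ne; rewrite (_ : (k == j - i)%N = false) ?mulr0 ?mul0rn //.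
by apply/negP => /eqP e; move: ne; rewrite e subKn ?eqxx // -ltnS.
Qed.

Lemma coef_shift (u : {poly C}) (t : C) N k : (size u <= N)%N ->
  (u \Po ('X + t%:P))`_k = \sum_(j < N) u`_j * (t ^+ (j - k) *+ 'C(j, k)).
Proof.
move=> uN; rewrite comp_polyE (big_ord_widen N (fun i => u`_i *: ('X + t%:P) ^+ i)) //.
rewrite big_mkcond coef_sum; apply: eq_bigr => j _.
rewrite -coef_XaddC_exp; case: ifP => [_|]; first by rewrite coefZ.
by move/negbT; rewrite -leqNgt => h; rewrite coef0 (nth_default _ h) mul0r.
Qed.

Variable t : P -> C.
Hypothesis t1 : bigO 1 t.

Let tpow d i j k : (d <= j - k)%N -> bigO d (fun p => t p ^+ (j - k) *+ i).
Proof.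
move=> dk; have h := bigOX (j - k) t1; rewrite mul1n in h.
have h' := bigOMr (bigOW dk h) (bigO_cst eps i%:R).
by apply: bigO_ext h' => p; rewrite mulr_natr.
Qed.

Lemma pbounded_shift u : pbounded u -> pbounded (fun p => u p \Po ('X + (t p)%:P)).
Proof.
move=> [[N hN] hu]; split.
  exists N.+1 => p; apply: leq_trans (size_comp_poly_leq _ _) _.
  rewrite ltnS size_XaddC muln1; exact: leq_trans (leq_pred _) (hN p).
move=> k; apply: bigO_bigsum (fun p => coef_shift _ _ (hN p)) _ => j.
by apply: bigOMl (hu _) _; apply: tpow.
Qed.

(** A coefficient of index [j >= M] enters with the factor [t^(j-k)]. *)
Lemma coef_shift_trunc u k M d : pbounded u -> (d <= M - k)%N ->
  bigO d (fun p => (u p \Po ('X + (t p)%:P))`_k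
     - \sum_(j < M) (u p)`_j * (t p ^+ (j - k) *+ 'C(j, k))).
Proof.
move=> [[N hN] hu] dM.
have hN' p : (size (u p) <= M + N)%N by rewrite (leq_trans (hN p)) ?leq_addl.
apply: (bigO_ext (y := fun p => \sum_(j < N)
   (u p)`_(M + j) * (t p ^+ (M + j - k) *+ 'C(M + j, k)))).
  by move=> p; rewrite (coef_shift _ _ (hN' p)) big_split_ord /= [X in X - _]addrC addrK.
apply: bigO_sum => j _; apply: bigOMl (hu _) _; apply: tpow.
by rewrite (leq_trans dM) // leq_sub2r // leq_addr.
Qed.

Lemma coef_shift_first u k : pbounded u ->
  bigO 1 (fun p => (u p \Po ('X + (t p)%:P))`_k - (u p)`_k).
Proof.
move=> bu; have h := @coef_shift_trunc u k k.+1 1%N bu.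
apply: bigO_ext (h _) => [p|]; last by rewrite subSn // subnn.
congr (_ - _); rewrite big_ord_recr /= subnn binn expr0 mulr1.
by rewrite big1 ?add0r // => j _; rewrite bin_small // mulr0n mulr0.
Qed.

End Shift.

Section Substitution.
Variables (R : realType).
Local Notation C := R[i].

Lemma peval_comp n (X : 'I_n -> {poly C}) (r : {poly C}) h :
  peval (fun l => X l \Po r) h = peval X h \Po r.
Proof.
rewrite /peval; elim/mpoly_ring_ind: h => [c|i|g h hg hh|g h hg hh].
- by rewrite !mmapC comp_polyC.
- by rewrite !mmapX !mmap1U.
- by rewrite mmapD [in RHS]mmapD comp_polyD hg hh.
- by rewrite [LHS]rmorphM [in RHS]rmorphM /= comp_polyM; congr (_ * _).
Qed.

(** Write [q = X^k q'] and [r = X r']. *)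
Lemma coef_comp_low (q r : {poly C}) k :
  r`_0 = 0 -> (forall j, (j < k)%N -> q`_j = 0) ->
  (forall j, (j < k)%N -> (q \Po r)`_j = 0) /\ (q \Po r)`_k = q`_k * r`_1 ^+ k.
Proof.
move=> r0 hq.
have low (a : {poly C}) d : (forall j, (j < d)%N -> a`_j = 0) ->
    a = drop_poly d a * 'X^d.
  move=> ha; rewrite -[LHS](poly_take_drop d) [X in X + _](_ : _ = 0) ?add0r//.
  by apply/polyP => j; rewrite coef_take_poly coef0; case: ifP => // /ha.
have hr : r = drop_poly 1 r * 'X by rewrite -['X]expr1; apply: low; case.
have -> : q \Po r = (drop_poly k q \Po r) * drop_poly 1 r ^+ k * 'X^k.
  by rewrite {1}(low q k hq) comp_polyM comp_Xn_poly {2}hr exprMn mulrA.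
split=> [j jk|]; first by rewrite coefMXn jk.
rewrite coefMXn ltnn subnn coef0M -!horner_coef0 horner_comp horner_exp.
by rewrite !horner_coef0 r0 horner_coef0 !coef_drop_poly !add0n.
Qed.

End Substitution.

(** * The second stage of the iteration *)

Section SecondStage.
Variables (R : realType) (P : Type) (eps : P -> R) (m mu : nat).
Local Notation C := R[i].
Local Notation bigO := (bigO eps).
Local Notation mbigO := (mbigO eps).
Local Notation away := (away eps).
Local Notation near0 := (near0 eps).
Local Notation pbounded := (pbounded eps).
Local Notation lowO := (lowO eps).
Hypothesis mu_gt1 : (1 < mu)%N.

Variables (f : polysys R m.+1) (xi : 'cV[C]_m.+1).
Variables (U0 V0 : 'M[C]_m.+1) (S0 : 'rV[R]_m.+1).
Hypothesis f_xi : seval f xi = 0.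
Hypothesis svd0 : is_svd (jacobian f xi) U0 S0 V0.
Hypothesis S0_last : S0 0 ord_max = 0.
Hypothesis S0_neq0 : forall i, i != ord_max -> S0 0 i != 0.

Let F0 := unitary_change U0 (rotcols V0) f.
Let p0 := (rotcols V0) ^t* *m xi.
Hypothesis Delta_low : forall k, (2 <= k <= mu.-1)%N ->
  dapply p0 (Delta F0 p0 k) (F0 ord_max 0) = 0.
Hypothesis Delta_mu : dapply p0 (Delta F0 p0 mu) (F0 ord_max 0) != 0.

Variables (zeta : P -> 'cV[C]_m.+1) (A B : P -> 'M[C]_m.+1) (S : P -> 'rV[R]_m.+1).
Variable g : P -> polysys R m.+1.
Hypothesis svd_zeta : forall p, is_svd (jacobian f (zeta p)) (A p) (S p) (B p).
Hypothesis g_change : forall p, is_change (A p) (rotcols (B p)) f (g p).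
Hypothesis zeta_near : mbigO 1 (fun p => zeta p - xi).
Hypothesis zeta_hat_near : forall j, j != ord_max ->
  bigO 2 (fun p => ((B p) ^t* *m (zeta p - xi)) j 0).

Local Notation T p := (U0 ^t* *m A p).
Local Notation Phi p := (V0 ^t* *m B p).
Local Notation s p j := ((S p 0 j)%:C%C).
Local Notation s0 j := ((S0 0 j)%:C%C).
Local Notation W p := (rotcols (B p)).
Local Notation W0 := (rotcols V0).
Local Notation w p := ((rotcols (B p)) ^t* *m zeta p).
Local Notation cv p := (curve (g p) (w p) mu).
(* [H] is the last equation along the curve of the recursion at [w]. *)
Local Notation H p := (peval_sys (g p) (cv p) ord_max).

Let jac_near := jacobian_continuous zeta_near f.

Let A_unitary p : A p \is unitarymx. Proof. by case: (svd_zeta p). Qed.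
Let B_unitary p : B p \is unitarymx. Proof. by case: (svd_zeta p). Qed.
Let W_unitary p : W p \is unitarymx. Proof. exact: rotcols_unitary. Qed.
Let V0_unitary : V0 \is unitarymx. Proof. by case: svd0. Qed.
Let W0_unitary : W0 \is unitarymx. Proof. exact: rotcols_unitary. Qed.
Let bA : mbigO 0 A. Proof. exact: mbigO_unitary. Qed.
Let bB : mbigO 0 B. Proof. exact: mbigO_unitary. Qed.
Let bW : mbigO 0 (fun p => W p). Proof. exact: mbigO_unitary. Qed.
Let bT : mbigO 0 (fun p => T p).
Proof. by apply: mbigO_unitary => p; exact: (svd_unitaryT svd0 svd_zeta). Qed.

Let s_away j : j != ord_max -> away (fun p => s p j).
Proof. exact: (svd_away svd0 S0_last S0_neq0 svd_zeta jac_near). Qed.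

Let WK p (x : 'cV[C]_m.+1) : W p *m ((W p) ^t* *m x) = x.
Proof. by rewrite mulmxA (unitary_mulC (W_unitary p)) mul1mx. Qed.

Let W0K (x : 'cV[C]_m.+1) : W0 *m (W0 ^t* *m x) = x.
Proof. by rewrite mulmxA (unitary_mulC W0_unitary) mul1mx. Qed.

Lemma singular_value_bounded j : bigO 0 (fun p => s p j).
Proof.
have h : mbigO 0 (fun p => (A p) ^t* *m jacobian f (zeta p) *m B p).
  apply: mbigOMl => //; apply: mbigOMl (jacobian_bounded zeta_near f).
  exact: mbigO_adj.
apply: bigO_ext (h j j) => p; have [_ _ _ _ ->] := svd_zeta p.
rewrite -!mulmxA (unitary_Cmul (B_unitary p)) mulmx1 mulmxA.
by rewrite (unitary_Cmul (A_unitary p)) mul1mx !mxE eqxx.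
Qed.

Lemma base_point_bounded : mbigO 0 (fun p => w p).
Proof. by apply: mbigOMl; [exact: mbigO_adj|exact: near_bounded zeta_near]. Qed.

Lemma jacobian_g p i j : jacobian (g p) (w p) i j = s p i * (i == ord_pred j)%:R.
Proof. exact: svd_change_jacobian (svd_zeta p) (@g_change p) erefl i j. Qed.

Lemma jacobian_hat_g p :
  jacobian_hat (g p) (w p) = diag_mx (\row_t s p (lift ord_max t)).
Proof.
exact: svd_change_jacobian_hat (svd_zeta p) (@g_change p) erefl.
Qed.

Lemma singular_values_neq0 : near0 (fun p => forall t : 'I_m, s p (lift ord_max t) != 0).
Proof.
apply: near0_all => t; apply: away_neq0.
exact: s_away (lift_max_neq t).
Qed.

Lemma jacobian_hat_unit : near0 (fun p => jacobian_hat (g p) (w p) \in unitmx).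
Proof.
apply: near0W singular_values_neq0 => p sp; rewrite jacobian_hat_g diag_mx_unit // => t.
by rewrite mxE.
Qed.

(** The first-order expansion of the equation of index [i] involves
    [zeta - xi] only through its component on the right singular vector of the
    same index. *)
Lemma hat_residual_small i : i != ord_max -> bigO 2 (fun p => seval (g p) (w p) i 0).
Proof.
move=> iL.
have h : mbigO 2 (fun p => (A p) ^t* *m
    (seval f (zeta p) - jacobian f (zeta p) *m (zeta p - xi))).
  by apply: mbigOMl; [exact: mbigO_adj|exact: seval_taylor].
have h' : bigO 2 (fun p => s p i * ((B p) ^t* *m (zeta p - xi)) i 0).
  exact: bigOMl (singular_value_bounded i) (zeta_hat_near iL).
apply: bigO_ext (bigOD (h i 0) h') => p.
rewrite (is_change_seval _ (@g_change p)) WK mulmxBr.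
have -> : (A p) ^t* *m (jacobian f (zeta p) *m (zeta p - xi)) =
    diag_mx (map_mx (real_complex R) (S p)) *m ((B p) ^t* *m (zeta p - xi)).
  have [_ _ _ _ ->] := svd_zeta p.
  by rewrite !mulmxA (unitary_Cmul (A_unitary p)) mul1mx.
rewrite mul_diag_mx [X in _ = X + _]mxE [X in _ = (_ + X) + _]mxE.
by rewrite [X in _ = (_ - X) + _]mxE [X in _ = (_ - X * _) + _]mxE subrK.
Qed.

Lemma pbounded_mulpoly a b (M : P -> 'M[C]_(a, b)) Y k :
  mbigO 0 M -> (forall l, pbounded (fun p => Y p l)) ->
  pbounded (fun p => mulpoly (M p) (Y p) k).
Proof.
move=> hM hY; apply: pbounded_sum => l; apply: pboundedM => //.
exact: pboundedC.
Qed.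

Lemma pbounded_curve K l :
  (forall k t, (0 < k <= K)%N -> bigO 0 (fun p => acoef (g p) (w p) k t 0)) ->
  pbounded (fun p => curve (g p) (w p) K l).
Proof.
move=> ha; apply: pboundedD; first exact/pboundedC/base_point_bounded.
split=> [|[|i]]; first by exists K.+1 => p; apply: size_poly.
  by apply: bigO_ext (bigO0 _ 0) => p; apply: coef0_curve_disp.
have [iK|iK] := ltnP i K.
  by apply: bigO_ext (ha i.+1 l iK) => p; rewrite coef_curve_disp.
by apply: bigO_ext (bigO0 _ 0) => p; rewrite coef_poly ltnS ltnNge iK.
Qed.

(** The vector [a_k] is a value of [f] along the curve truncated at degree
    [k - 1], divided by singular values that are bounded away from zero. *)
Lemma acoef_bounded k t : (0 < k)%N -> bigO 0 (fun p => acoef (g p) (w p) k t 0).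
Proof.
have [N] := ubnP k; elim: N => // N ih in k t * => kN k0.
case: k kN k0 => [|[|k]] // kN _; first exact: bigO_cst.
have bc l : pbounded (fun p => curve (g p) (w p) k.+1 l).
  apply: pbounded_curve => j u /andP[j0 jk]; apply: ih => //.
  exact: leq_ltn_trans jk kN.
case: (unliftP ord0 t) => [u|] ->; last first.
  by apply: bigO_ext (bigO0 _ 0) => p; rewrite acoefE // mxE unlift_none.
apply: (bigO_ext (y := fun p => ahat (g p) (w p) k.+2 u 0)) => [p|].
  by rewrite acoefE // mxE liftK.
apply: (bigO_cancel (x := fun p => s p (lift ord_max u))).
  exact: s_away (lift_max_neq u).
apply: (bigO_near (y := fun p => - (peval_sys (g p) (curve (g p) (w p) k.+1)
    (lift ord_max u))`_k.+2)).
  apply: near0W jacobian_hat_unit => p hp.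
  rewrite /ahat /peval_sys -(dapply_Delta _ _ _ (isT : 1 < k.+2)%N).
  set rhs := \col_i _.
  have : (jacobian_hat (g p) (w p) *m (- (invmx (jacobian_hat (g p) (w p)) *m rhs))) u 0
      = - rhs u 0.
    by rewrite mulmxN mulKVmx // mxE.
  by rewrite {1}jacobian_hat_g mul_diag_mx mxE [X in X * _]mxE [rhs u 0]mxE.
have [_ hb] : pbounded (fun p => peval_sys (g p) (curve (g p) (w p) k.+1) (lift ord_max u)).
  rewrite (_ : (fun _ => _) = fun p => mulpoly ((A p) ^t*)
      (peval_sys f (mulpoly (W p) (curve (g p) (w p) k.+1))) (lift ord_max u)).
    apply: pbounded_mulpoly; first exact: mbigO_adj.
    by move=> l; apply: pbounded_peval => l'; apply: pbounded_mulpoly.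
  by apply: funext => p; rewrite g_change.
exact/bigON/hb.
Qed.

Lemma pbounded_base_curve l : pbounded (fun p => cv p l).
Proof. by apply: pbounded_curve => k t /andP[k0 _]; apply: acoef_bounded. Qed.

Lemma hat_equations_on_curve j i : (0 < j <= mu)%N -> i != ord_max ->
  near0 (fun p => (peval_sys (g p) (cv p) i)`_j = 0).
Proof.
move=> hj /lift_maxP[t ->]; apply: near0W jacobian_hat_unit => p hp.
case: j hj => [|[|j]] // hj; last exact: peval_hat_curve.
rewrite /peval_sys coef1_peval_curve; last exact: ltnW.
have := jacobian_g p (lift ord_max t) ord0; rewrite mxE => ->.
by rewrite ord_pred0 (negPf (lift_max_neq t)) mulr0.
Qed.

Lemma last_equation_on_curve j p : (0 < j <= mu)%N ->
  (H p)`_j = dapply (w p) (Delta (g p) (w p) j) (g p ord_max 0).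
Proof.
move=> hj; apply: peval_last_curve => // t.
by rewrite jacobian_g ord_pred_lift eq_sym (negPf (lift_max_neq t)) mulr0.
Qed.

(* [Gam] is the curve in the original coordinates, and [G] the system along it
   in the left singular basis of [Df xi]. *)
Local Notation Gam p := (mulpoly (W p) (cv p)).
Local Notation G p := (mulpoly (U0 ^t*) (peval_sys f (Gam p))).

Lemma reference_frame_eq p : G p = mulpoly (T p) (peval_sys (g p) (cv p)).
Proof.
by rewrite g_change mulpolyA -(mulmxA _ (A p)) (unitary_mulC (A_unitary p)) mulmx1.
Qed.

Lemma coef_in_reference_frame i j : (j <= mu)%N ->
  bigO 2 (fun p => (G p i)`_j - T p i ord_max * (H p)`_j).
Proof.
move=> jmu; apply: (bigO_ext (y := fun p => \sum_(l | l != ord_max)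
    T p i l * (peval_sys (g p) (cv p) l)`_j)).
  by move=> p; rewrite reference_frame_eq coef_mulpoly (bigD1 ord_max) //= [X in X - _]addrC addrK.
apply: bigO_sum => l lL; apply: bigOMl (bT i l) _.
case: j jmu => [_|j jmu].
  apply: bigO_ext (hat_residual_small lL) => p; apply: seval_coef0 => k.
  by rewrite coef0_curve.
by apply: bigO_near (bigO0 _ _); apply: (@hat_equations_on_curve j.+1).
Qed.

Lemma pbounded_ambient_curve k : pbounded (fun p => Gam p k).
Proof. by apply: pbounded_mulpoly => // l; apply: pbounded_base_curve. Qed.

Lemma pbounded_reference_frame i : pbounded (fun p => G p i).
Proof.
apply: pbounded_mulpoly => [|l]; first exact: mbigO_cst.
by apply: pbounded_peval => k; apply: pbounded_ambient_curve.
Qed.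

(** The correction of the first coordinate that would lead exactly to [xi]. *)
Definition tau p := (W p ^t* *m (xi - zeta p)) ord0 0.

Lemma displacement_near : mbigO 1 (fun p => W p ^t* *m (xi - zeta p)).
Proof.
apply: mbigOMl; first exact: mbigO_adj.
by apply: mbigO_ext (mbigON zeta_near) => p; rewrite opprB.
Qed.

Lemma displacement_hat_near t : bigO 2 (fun p => (W p ^t* *m (xi - zeta p)) (lift ord0 t) 0).
Proof.
apply: bigO_ext (bigON (zeta_hat_near (lift_max_neq t))) => p.
by rewrite rotcols_adj_mul ord_pred_lift -opprB mulmxN [LHS]mxE.
Qed.

Lemma tau_small : bigO 1 tau. Proof. exact: displacement_near. Qed.

Lemma curve_lift p t : cv p (lift ord0 t) =
  (w p (lift ord0 t) 0)%:P + \poly_(j < mu.+1) (if (j <= 1)%N then 0 else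
     acoef (g p) (w p) j (lift ord0 t) 0).
Proof.
congr (_ + _); apply/polyP => i; rewrite !coef_poly; case: ifP => // _.
by case: i => [|[|i]] //=; rewrite acoef1 mxE.
Qed.

(** The first coordinate of the curve is the parameter itself, so [tau]
    makes it exact; in the other coordinates the curve leaves its base point only
    at order two. *)
Lemma curve_at_tau l : bigO 2 (fun p => (cv p l).[tau p] - (W p ^t* *m xi) l 0).
Proof.
case: (unliftP ord0 l) => [t|] ->.
  apply: (bigO_ext (y := fun p =>
     \sum_(j < mu.+1) (if (j <= 1)%N then 0 else
     acoef (g p) (w p) j (lift ord0 t) 0) * tau p ^+ j
      - (W p ^t* *m (xi - zeta p)) (lift ord0 t) 0)).
    move=> p; rewrite curve_lift hornerD hornerC horner_poly mulmxBr [in RHS]mxE.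
    by rewrite [X in _ = _ - (_ + X)]mxE; ring.
  apply: bigOB (displacement_hat_near t); apply: bigO_sum => j _.
  case: leqP => j1; first by apply: bigO_ext (bigO0 _ _) => p; rewrite mul0r.
  apply: bigOMl; first by apply: acoef_bounded; apply: ltnW.
  by apply: bigOW (bigOX j tau_small); rewrite mul1n.
apply: bigO_ext (bigO0 _ _) => p; rewrite curve_ord0 ?(ltnW mu_gt1) // hornerD hornerC hornerX /tau.
by rewrite mulmxBr [X in _ + X - _]mxE [X in _ + (_ + X) - _]mxE; ring.
Qed.

Lemma closing_gap_small k : bigO 2 (fun p => xi k 0 - (Gam p k).[tau p]).
Proof.
apply: (bigO_ext (y := fun p => - \sum_l W p k l *
    ((cv p l).[tau p] - (W p ^t* *m xi) l 0))).
  move=> p; rewrite -[xi in LHS](WK p) mxE horner_sum -sumrB -sumrN.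
  by apply: eq_bigr => l _; rewrite hornerM hornerC; ring.
by apply/bigON/bigO_sum => l _; apply: bigOMl (curve_at_tau l).
Qed.

(* Recentring at [tau]: the constant [gap] moves the base point exactly to [xi],
   [gam] is the recentred curve and [Fg] the system along it, both in the
   singular coordinates of [Df xi]. *)
Local Notation sh p := ('X + (tau p)%:P).
Local Notation Gams p := (fun k => Gam p k \Po sh p).
Local Notation gap p := (fun k => (xi k 0 - (Gam p k).[tau p])%:P).
Local Notation Gamt p := (fun k => Gams p k + gap p k).
Local Notation gam p := (mulpoly (W0 ^t*) (Gamt p)).
Local Notation Fg p := (peval_sys F0 (gam p)).

Lemma pbounded_shifted k : pbounded (fun p => Gams p k).
Proof. exact: pbounded_shift tau_small _ (pbounded_ambient_curve k). Qed.

Lemma pbounded_closing_gap k : pbounded (fun p => gap p k).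
Proof. by apply: pboundedC; apply: bigOW (closing_gap_small k). Qed.

Lemma pbounded_recentred k : pbounded (fun p => gam p k).
Proof.
apply: pbounded_mulpoly => [|l]; first exact: mbigO_cst.
by apply: pboundedD; [exact: pbounded_shifted|exact: pbounded_closing_gap].
Qed.

Lemma recentred_in_reference_frame p : Fg p = mulpoly (U0 ^t*) (peval_sys f (Gamt p)).
Proof.
by rewrite unitary_change_is_change mulpolyA (unitary_mulC W0_unitary) mulpoly1.
Qed.

Lemma shift_reference_frame p i : mulpoly (U0 ^t*) (peval_sys f (Gams p)) i = G p i \Po sh p.
Proof.
rewrite /mulpoly linear_sum /=; apply: eq_bigr => l _.
by rewrite comp_polyM comp_polyC /peval_sys peval_comp.
Qed.

Lemma recentring_error i k : bigO 2 (fun p => (Fg p i)`_k - (G p i \Po sh p)`_k).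
Proof.
apply: (bigO_ext (y := fun p => \sum_l (U0 ^t*) i l *
   (peval_sys f (Gamt p) l - peval_sys f (Gams p) l)`_k)).
  move=> p; rewrite recentred_in_reference_frame -shift_reference_frame !coef_mulpoly -sumrB.
  by apply: eq_bigr => l _; rewrite coefB mulrBr.
apply: bigO_sum => l _; apply: bigOMl; first exact: bigO_cst.
apply: (@lowO_peval _ _ _ _ 2 k.+1 (fun p => Gams p) (fun p => gap p)) => //.
- exact: pbounded_shifted.
- exact: pbounded_closing_gap.
move=> a [|j] _; first by apply: bigO_ext (closing_gap_small a) => p; rewrite coefC.
by apply: bigO_ext (bigO0 _ _) => p; rewrite coefC.
Qed.

(** The coefficient of degree [k] of [H(t + tau)], where [H] is truncated at
    degree [mu]. *)
Definition eta k p := \sum_(j < mu.+1) (H p)`_j * (tau p ^+ (j - k) *+ 'C(j, k)).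

(** The coefficients of degree above [mu] come with a factor [tau^2] at
    least, the first equations along the curve are [O(eps^2)], and so is the
    error of recentring. *)
Lemma recentred_coef_low i k : (k < mu)%N ->
  bigO 2 (fun p => (Fg p i)`_k - T p i ord_max * eta k p).
Proof.
move=> kmu.
have h1 := recentring_error i k.
have h2 : bigO 2 _ :=
  coef_shift_trunc tau_small (k := k) (M := mu.+1) (pbounded_reference_frame i) _.
have h3 : bigO 2 (fun p => \sum_(j < mu.+1)
   ((G p i)`_j - T p i ord_max * (H p)`_j) * (tau p ^+ (j - k) *+ 'C(j, k))).
  apply: bigO_sum => j _; apply: bigOMr; first by apply: coef_in_reference_frame; rewrite -ltnS.
  have := bigOW (leq0n _) (bigOX (j - k) tau_small) => h.
  by apply: bigO_ext (bigOMr h (bigO_cst eps 'C(j, k)%:R)) => p; rewrite mulr_natr.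
have kmu2 : (2 <= mu.+1 - k)%N by rewrite subSn ?ltnS ?subn_gt0 // ltnW.
apply: bigO_ext (bigOD h1 (bigOD (h2 kmu2) h3)) => p.
under [X in _ = _ + (_ + X)]eq_bigr do rewrite mulrBl -mulrA.
by rewrite sumrB -mulr_sumr /eta; ring.
Qed.

Lemma recentred_coef_mu i : bigO 1 (fun p => (Fg p i)`_mu - T p i ord_max * (H p)`_mu).
Proof.
have h1 := bigOW (isT : 1 <= 2)%N (recentring_error i mu).
have h2 := coef_shift_first tau_small mu (pbounded_reference_frame i).
have h3 := bigOW (isT : 1 <= 2)%N (coef_in_reference_frame i (leqnn mu)).
by apply: bigO_ext (bigOD h1 (bigOD h2 h3)) => p; ring.
Qed.

Let x0 := curve F0 p0 mu.
Let c0 := dapply p0 (Delta F0 p0 mu) (F0 ord_max 0).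

Let F0_jacobian i j : jacobian F0 p0 i j = s0 i * (i == ord_pred j)%:R.
Proof.
exact: svd_change_jacobian svd0 (@unitary_change_is_change _ _ _ _ _) erefl i j.
Qed.

Lemma F0_hat_unit : jacobian_hat F0 p0 \in unitmx.
Proof.
rewrite (svd_change_jacobian_hat svd0 (@unitary_change_is_change _ _ _ _ _) erefl).
apply: diag_mx_unit => t; rewrite mxE (inj_eq (@complexI _)).
exact: S0_neq0 (lift_max_neq t).
Qed.

(** This is the definition of a zero of multiplicity [mu], together with
    [f xi = 0] in degree zero and the vanishing last singular value in degree
    one. *)
Lemma reference_low i k : (k < mu)%N -> (peval_sys F0 x0 i)`_k = 0.
Proof.
case: k => [_|[|k] kmu].
- rewrite (@seval_coef0 _ _ F0 p0) => [|l]; last exact: coef0_curve.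
  rewrite (is_change_seval _ (@unitary_change_is_change _ _ _ _ _)) W0K f_xi.
  by rewrite mulmx0 mxE.
- rewrite /peval_sys coef1_peval_curve; last exact: ltnW.
  have := F0_jacobian i ord0; rewrite mxE => ->; rewrite ord_pred0.
  by case: eqP => [->|]; rewrite ?S0_last ?mul0r ?mulr0.
have [/lift_maxP[t ->]|/negPn/eqP->] := boolP (i != ord_max).
  by apply: peval_hat_curve F0_hat_unit _; rewrite /= ltnW.
rewrite /peval_sys peval_last_curve.
- by apply: Delta_low; rewrite /= -ltnS prednK // ltnW.
- move=> t; rewrite F0_jacobian ord_pred_lift eq_sym (negPf (lift_max_neq t)).
  by rewrite mulr0.
- by rewrite /= ltnW.
Qed.

Lemma reference_mu : (peval_sys F0 x0 ord_max)`_mu = c0.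
Proof.
apply: peval_last_curve => [t|]; last by rewrite leqnn ltnW.
by rewrite F0_jacobian ord_pred_lift eq_sym (negPf (lift_max_neq t)) mulr0.
Qed.

(* [sig] is the parameter at which the reference curve has the first coordinate
   of the recentred one, [Y] the reparametrised reference curve and [e] the
   deviation. *)
Local Notation sig p := (gam p ord0 - (p0 ord0 0)%:P).
Local Notation Y p := (fun l => x0 l \Po sig p).
Local Notation e p := (fun l => gam p l - Y p l).

Lemma coef0_recentred p k : (gam p k)`_0 = p0 k 0.
Proof.
rewrite coef_mulpoly mxE; apply: eq_bigr => l _; congr (_ * _).
rewrite coefD coefC -horner_coef0 horner_comp hornerD hornerX hornerC add0r.
by rewrite addrC subrK.
Qed.

Lemma coef0_parameter p : (sig p)`_0 = 0.
Proof. by rewrite coefB coefC coef0_recentred subrr. Qed.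

Lemma coef0_reparametrised p l : (Y p l)`_0 = p0 l 0.
Proof.
rewrite -horner_coef0 horner_comp horner_coef0 coef0_parameter horner_coef0.
exact: coef0_curve.
Qed.

(** The parameter of the reference curve is chosen to make the first
    coordinates agree. *)
Lemma deviation_ord0 p : e p ord0 = 0.
Proof.
rewrite /x0 (curve_ord0 _ _ (ltnW mu_gt1)) comp_polyD comp_polyC comp_polyX.
by rewrite subrKC subrr.
Qed.

Lemma pbounded_comp (q : {poly C}) u : pbounded u -> pbounded (fun p => q \Po u p).
Proof.
move=> bu; rewrite (_ : (fun _ => _) = fun p => \sum_(i < size q) (q`_i)%:P * u p ^+ i).
  apply: pbounded_sum => i; apply: pboundedM; first exact: pbounded_cst.
  elim: (val i) => [|j ih]; first exact: (pbounded_cst _ 1).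
  rewrite (_ : (fun _ => _) = fun p => u p * u p ^+ j); first exact: pboundedM.
  by apply: funext => p; rewrite exprS.
by apply: funext => p; rewrite comp_polyE; apply: eq_bigr => i _; rewrite mul_polyC.
Qed.

Lemma pbounded_reparametrised l : pbounded (fun p => Y p l).
Proof.
apply: pbounded_comp; apply: pboundedD (pbounded_recentred _) _.
exact: pbounded_cst.
Qed.

Lemma pbounded_deviation l : pbounded (fun p => e p l).
Proof.
apply: pboundedD (pbounded_recentred _) _.
rewrite (_ : (fun _ => _) = fun p => (-1)%:P * Y p l).
  by apply: pboundedM (pbounded_reparametrised l); apply: pbounded_cst.
by apply: funext => p; rewrite polyCN mulNr mul1r.
Qed.

Lemma reparametrised_low p i k : (k < mu)%N -> (peval_sys F0 (Y p) i)`_k = 0.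
Proof.
move=> kmu; rewrite /peval_sys peval_comp.
have [h _] := coef_comp_low (coef0_parameter p) (fun j => @reference_low i j).
exact: h.
Qed.

Lemma reparametrised_mu p : (peval_sys F0 (Y p) ord_max)`_mu = c0 * (sig p)`_1 ^+ mu.
Proof.
rewrite /peval_sys peval_comp.
have [_ ->] := coef_comp_low (coef0_parameter p) (fun j => @reference_low ord_max j).
by congr (_ * _); exact: reference_mu.
Qed.

Lemma deviation_linearised k i : (0 < k)%N -> (forall l, lowO 2 k (fun p => e p l)) ->
  bigO 2 (fun p => (Fg p i)`_k - (peval_sys F0 (Y p) i)`_k
     - \sum_l jacobian F0 p0 i l * (e p l)`_k).
Proof.
move=> k0 ek.
have e1 l : lowO 2 1 (fun p => e p l) by case=> // _; apply: ek.
have := lowO_coef_peval (F0 i 0) pbounded_reparametrised pbounded_deviation ek e1.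
apply: bigO_ext => p; congr (_ - _ - _).
  congr (peval _ _)`_k; apply: funext => l; by rewrite subrKC.
apply: eq_bigr => l _; rewrite mxE; congr (_ * _); apply: meval_eq => a.
by rewrite coef0_reparametrised.
Qed.

(** The last row of the reference Jacobian is zero, so the last equation
    does not see the deviation to first order. *)
Lemma deviation_linearised_last k : (0 < k)%N -> (forall l, lowO 2 k (fun p => e p l)) ->
  bigO 2 (fun p => (Fg p ord_max)`_k - (peval_sys F0 (Y p) ord_max)`_k).
Proof.
move=> k0 /(deviation_linearised ord_max k0); apply: bigO_ext => p.
rewrite big1 ?subr0 // => l _; rewrite F0_jacobian S0_last.
by rewrite mul0r mul0r.
Qed.

Lemma last_left_vectors_close : away (fun p => T p ord_max ord_max).
Proof. exact: (svd_T_last svd0 S0_last S0_neq0 svd_zeta jac_near). Qed.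

Lemma eta_small_of_deviation k : (0 < k < mu)%N -> (forall l, lowO 2 k (fun p => e p l)) ->
  bigO 2 (eta k).
Proof.
move=> /andP[k0 kmu] ek; apply: (bigO_cancel last_left_vectors_close).
apply: bigO_ext (bigOB (deviation_linearised_last k0 ek) (recentred_coef_low ord_max kmu)) => p.
by rewrite reparametrised_low //; ring.
Qed.

(** In degree [k] the last equation shows that [eta k] is [O(eps^2)];
    each other equation then bounds one coordinate of the deviation, multiplied
    by a nonzero singular value of [Df xi]. *)
Lemma deviation_small k : (0 < k <= mu)%N -> forall l, lowO 2 k (fun p => e p l).
Proof.
elim: k => // k ih /andP[_ kmu] l.
case: k ih kmu => [_ _|k ih kmu].
  case=> // _; apply: bigO_ext (bigO0 _ _) => p.
  by rewrite coefB coef0_recentred coef0_reparametrised subrr.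
have ek := ih (ltnW kmu).
move=> i; rewrite ltnS leq_eqVlt => /orP[/eqP->|ik]; last exact: ek.
case: (unliftP ord0 l) => [t|] ->; last first.
  by apply: bigO_ext (bigO0 _ _) => p; rewrite deviation_ord0 coef0.
have h := deviation_linearised (lift ord_max t) (ltn0Sn k) ek.
have h1 := recentred_coef_low (lift ord_max t) kmu.
have h2 : bigO 2 (fun p => T p (lift ord_max t) ord_max * eta k.+1 p).
  by apply: bigOMl (bT _ _) _; apply: eta_small_of_deviation.
apply: (bigO_cancel (x := fun=> s0 (lift ord_max t))).
  by apply: away_cst; rewrite (inj_eq (@complexI _)) S0_neq0 // lift_max_neq.
apply: bigO_ext (bigOB (bigOD h1 h2) h) => p.
rewrite reparametrised_low // (bigD1 (lift ord0 t)) //= big1 => [|a at_].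
  by rewrite F0_jacobian ord_pred_lift eqxx mulr1; ring.
rewrite F0_jacobian -ord_pred_lift; case: eqP => [/ord_pred_inj ta|_].
  by rewrite ta eqxx in at_.
by rewrite mulr0 mul0r.
Qed.

(** The recentred curve leaves [xi] along the last right singular vector
    up to [O(eps)], and that vector is close to the one of [Df xi] up to a phase. *)
Lemma speed_away : away (fun p => (sig p)`_1).
Proof.
have hPhi : away (fun p => Phi p ord_max ord_max).
  exact: (svd_Phi_last svd0 S0_last S0_neq0 svd_zeta jac_near).
apply: (away_perturb hPhi).
apply: (bigO_ext (y := fun p => \sum_k (W0 ^t*) ord0 k *
   ((Gams p k)`_1 - (Gam p k)`_1))).
  move=> p; have -> : Phi p ord_max ord_max = \sum_k (W0 ^t*) ord0 k * (Gam p k)`_1.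
    rewrite mxE; apply: eq_bigr => k _; rewrite !adjE rotcolsE ord_pred0; congr (_ * _).
    rewrite coef_mulpoly (bigD1 ord0) //= big1 => [|l l0].
      by rewrite coef_curve ?(ltnW mu_gt1) // acoef1 rotcolsE ord_pred0 mxE !eqxx mulr1 addr0.
    by rewrite coef_curve ?(ltnW mu_gt1) // acoef1 [delta_mx _ _ _ _]mxE (negPf l0) mulr0.
  rewrite coefB coefC subr0 coef_mulpoly -sumrB; apply: eq_bigr => k _.
  by rewrite coefD coefC addr0 mulrBr.
apply: bigO_sum => k _; apply: bigOMl; first exact: bigO_cst.
exact: (coef_shift_first tau_small 1%N (pbounded_ambient_curve k)).
Qed.

(** Up to the factor [T_LL] and to [O(eps)], this coefficient is the leading
    coefficient of the reference equation times a power of the speed of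
    reparametrisation. *)
Lemma leading_coef_away : away (fun p => (H p)`_mu).
Proof.
have mu0 := ltnW mu_gt1.
apply: (away_factor (bT ord_max ord_max)).
have hc : away (fun p => c0 * (sig p)`_1 ^+ mu).
  by apply: awayM; [exact: away_cst|exact: awayX speed_away].
apply: (away_perturb hc).
have dev := deviation_small (introT andP (conj mu0 (leqnn mu))).
have h1 := bigOW (isT : 1 <= 2)%N (deviation_linearised_last mu0 dev).
apply: bigO_ext (bigOB h1 (recentred_coef_mu ord_max)) => p.
by rewrite reparametrised_mu; ring.
Qed.

Lemma penultimate_coef_small : bigO 2 (fun p => (H p)`_mu.-1 + mu%:R * tau p * (H p)`_mu).
Proof.
have hk : (0 < mu.-1 < mu)%N by have := mu_gt1; lia.
have hk' : (0 < mu.-1 <= mu)%N by case/andP: hk => -> /ltnW.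
have := eta_small_of_deviation hk (deviation_small hk'); apply: bigO_ext => p; rewrite /eta.
rewrite big_ord_recr /=.
(* Only the degrees [mu - 1] and [mu] contribute to this coefficient. *)
have -> : mu = mu.-1.+1 by rewrite prednK // ltnW.
rewrite big_ord_recr /= big1 => [|j _]; last by rewrite bin_small // mulr0n mulr0.
by rewrite subnn binn subSnn binSn -mulr_natl; ring.
Qed.

Lemma newton_correction_small :
  bigO 2 (fun p => - (mu%:R^-1 * ((H p)`_mu)^-1 * (H p)`_mu.-1) - tau p).
Proof.
have mu0 : (mu%:R : C) != 0 by rewrite pnatr_eq0 -lt0n ltnW.
have inv := bigOMl (bigO_cst eps (- mu%:R^-1)) (bigOV leading_coef_away).
apply: bigO_near (bigOMl inv penultimate_coef_small).
by apply: near0W (away_neq0 leading_coef_away) => p Hp; field; rewrite Hp.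
Qed.

Lemma second_stage_defined : near0 (fun p => jacobian_hat (g p) (w p) \in unitmx /\
  dapply (w p) (Delta (g p) (w p) mu) (g p ord_max 0) != 0).
Proof.
apply: near0I jacobian_hat_unit _; apply: near0W (away_neq0 leading_coef_away) => p.
by rewrite last_equation_on_curve // leqnn ltnW.
Qed.

Definition refined_point p := vcons (w p ord0 0 -
     mu%:R^-1 * (dapply (w p) (Delta (g p) (w p) mu) (g p ord_max 0))^-1
       * dapply (w p) (Delta (g p) (w p) mu.-1) (g p ord_max 0)) (vhat (w p)).

Lemma second_stage_quadratic : mbigO 2 (fun p => W p *m refined_point p - xi).
Proof.
have h : mbigO 2 (fun p => refined_point p - W p ^t* *m xi).
  move=> i j; rewrite ord1 {j}; case: (unliftP ord0 i) => [t|] ->.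
    apply: bigO_ext (bigON (displacement_hat_near t)) => p; rewrite /refined_point.
    rewrite mxE [X in X + _]mxE liftK [X in X + _]mxE mulmxBr.
    by rewrite [X in _ = - X]mxE [X in _ = - (_ + X)]mxE [X in _ + X]mxE; ring.
  apply: bigO_ext newton_correction_small => p.
  rewrite /refined_point mxE [X in X + _]mxE unlift_none -!last_equation_on_curve ?leqnn ?(ltnW mu_gt1) //.
    by rewrite /tau mulmxBr [X in _ = _ - X]mxE [X in _ = _ - (_ + X)]mxE [X in _ + X]mxE; ring.
  by have := mu_gt1; lia.
by apply: mbigO_ext (mbigOMl bW h) => p; rewrite mulmxBr WK.
Qed.

End SecondStage.

(** * The first stage and the conclusion *)

Section Hnorm.
Variables (R : realType) (n : nat).
Local Notation C := R[i].
Implicit Types v : 'cV[C]_n.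

Lemma hnorm_ge0 v : 0 <= hnorm v.
Proof. exact: sqrtr_ge0. Qed.

Lemma cabs_le_hnorm v i : cabs (v i 0) <= hnorm v.
Proof.
rewrite -[leLHS]ger0_norm ?cabs_ge0// -sqrtr_sqr ler_wsqrtr // (bigD1 i) //=.
by rewrite lerDl sumr_ge0 // => j _; rewrite sqr_ge0.
Qed.

Lemma hnorm_le_sum v : hnorm v <= \sum_i cabs (v i 0).
Proof.
have s0 : 0 <= \sum_i cabs (v i 0) by apply: sumr_ge0 => i _; apply: cabs_ge0.
rewrite -[leRHS]ger0_norm // -sqrtr_sqr ler_wsqrtr // expr2 mulr_suml.
apply: ler_sum => i _; rewrite expr2 ler_wpM2l ?cabs_ge0 // (bigD1 i) //=.
by rewrite lerDl sumr_ge0 // => j _; apply: cabs_ge0.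
Qed.

Lemma mbigO_hnorm (P : Type) (eps : P -> R) k (v : P -> 'cV[C]_n) : mbigO eps k v ->
  exists K, near0 eps (fun p => hnorm (v p) <= K * `|eps p| ^+ k).
Proof.
move=> hv; have /choice[K hK] : forall i, exists Ki,
    near0 eps (fun p => cabs (v p i 0) <= Ki * `|eps p| ^+ k) by move=> i; apply: hv.
exists (\sum_i K i); apply: near0W (near0_all hK) => p hp.
by apply: le_trans (hnorm_le_sum _) _; rewrite mulr_suml ler_sum.
Qed.

End Hnorm.

Section FirstStage.
Variables (R : realType) (P : Type) (eps : P -> R) (m : nat).
Local Notation C := R[i].
Local Notation bigO := (bigO eps).
Local Notation mbigO := (mbigO eps).
Local Notation near0 := (near0 eps).

Variables (f : polysys R m.+1) (xi : 'cV[C]_m.+1).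
Variables (U0 V0 : 'M[C]_m.+1) (S0 : 'rV[R]_m.+1).
Hypothesis f_xi : seval f xi = 0.
Hypothesis svd0 : is_svd (jacobian f xi) U0 S0 V0.
Hypothesis S0_last : S0 0 ord_max = 0.
Hypothesis S0_neq0 : forall i, i != ord_max -> S0 0 i != 0.

Variables (z : P -> 'cV[C]_m.+1).
Variables (U V U' V' : P -> 'M[C]_m.+1) (S S' : P -> 'rV[R]_m.+1).
Hypothesis z_near : mbigO 1 (fun p => z p - xi).
Hypothesis svd_z : forall p, is_svd (jacobian f (z p)) (U p) (S p) (V p).

Local Notation F p := (newtonF f (U p) (V p)).
Local Notation a p := (newton_a (z p) (V p)).
Local Notation y p := (newton_y f (z p) (U p) (V p)).
Local Notation W p := (rotcols (V p)).
Local Notation s p j := ((S p 0 j)%:C%C).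

Hypothesis svd_y : forall p, is_svd (jacobian (F p) (y p)) (U' p) (S' p) (V' p).

Let zeta p := W p *m y p.
Let A p := U p *m U' p.
Let B p := W p *m V' p.

Let jac_near := jacobian_continuous z_near f.
Let U_unitary p : U p \is unitarymx. Proof. by case: (svd_z p). Qed.
Let V_unitary p : V p \is unitarymx. Proof. by case: (svd_z p). Qed.
Let U'_unitary p : U' p \is unitarymx. Proof. by case: (svd_y p). Qed.
Let V'_unitary p : V' p \is unitarymx. Proof. by case: (svd_y p). Qed.
Let W_unitary p : W p \is unitarymx. Proof. exact: rotcols_unitary. Qed.
Let W'_unitary p : rotcols (V' p) \is unitarymx. Proof. exact: rotcols_unitary. Qed.

Let F_change p : is_change (U p) (W p) f (F p).
Proof. exact: unitary_change_is_change. Qed.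

Lemma first_jacobian_hat p :
  jacobian_hat (F p) (a p) = diag_mx (\row_t s p (lift ord_max t)).
Proof. exact: svd_change_jacobian_hat (svd_z p) (@F_change p) erefl. Qed.

Let s_away j : j != ord_max -> away eps (fun p => s p j).
Proof. exact: (svd_away svd0 S0_last S0_neq0 svd_z jac_near). Qed.

Lemma first_jacobian_hat_unit : near0 (fun p => jacobian_hat (F p) (a p) \in unitmx).
Proof.
have h : near0 (fun p => forall t : 'I_m, s p (lift ord_max t) != 0).
  by apply: near0_all => t; apply: away_neq0; exact: s_away (lift_max_neq t).
apply: near0W h => p sp; rewrite first_jacobian_hat diag_mx_unit // => t.
by rewrite mxE.
Qed.

Lemma first_displacement p : W p ^t* *m (zeta p - xi) = y p - W p ^t* *m xi.
Proof. by rewrite mulmxBr mulmxA (unitary_Cmul (W_unitary p)) mul1mx. Qed.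

Lemma first_ord0 : bigO 1 (fun p => (W p ^t* *m (zeta p - xi)) ord0 0).
Proof.
have h : mbigO 1 (fun p => W p ^t* *m (z p - xi)).
  by apply: mbigOMl => //; apply: mbigO_adj; apply: mbigO_unitary.
apply: bigO_ext (h ord0 0) => p.
rewrite first_displacement mulmxBr mxE [X in X + _]mxE unlift_none.
by rewrite [RHS]mxE.
Qed.

(** After division by the singular values, the correction of the hatted
    coordinates cancels the linear part of [f z] in the direction [z - xi]. *)
Lemma first_lift t : bigO 2 (fun p => (W p ^t* *m (zeta p - xi)) (lift ord0 t) 0).
Proof.
have h : mbigO 2 (fun p => U p ^t* *m
    (seval f (z p) - jacobian f (z p) *m (z p - xi))).
  by apply: mbigOMl; [apply: mbigO_adj; apply: mbigO_unitary|exact: seval_taylor].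
apply: (bigO_cancel (s_away (lift_max_neq t))).
apply: bigO_near (bigON (h (lift ord_max t) 0)).
apply: near0W first_jacobian_hat_unit => p hp.
pose d := invmx (jacobian_hat (F p) (a p)) *m seval_hat (F p) (a p).
have hd : s p (lift ord_max t) * d t 0 = (U p ^t* *m seval f (z p)) (lift ord_max t) 0.
  have : (jacobian_hat (F p) (a p) *m d) t 0 = seval_hat (F p) (a p) t 0.
    by rewrite /d mulKVmx.
  rewrite {1}first_jacobian_hat mul_diag_mx mxE [X in X * _]mxE => ->.
  rewrite mxE (is_change_seval _ (@F_change p)) /newton_a mulmxA.
  by rewrite (unitary_mulC (W_unitary p)) mul1mx.
have hJ : U p ^t* *m (jacobian f (z p) *m (z p - xi)) =
    diag_mx (map_mx (real_complex R) (S p)) *m ((V p) ^t* *m (z p - xi)).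
  have [_ _ _ _ ->] := svd_z p.
  by rewrite !mulmxA (unitary_Cmul (U_unitary p)) mul1mx.
have -> : (W p ^t* *m (zeta p - xi)) (lift ord0 t) 0 =
   (W p ^t* *m (z p - xi)) (lift ord0 t) 0 - d t 0.
  have yE : y p (lift ord0 t) 0 = a p (lift ord0 t) 0 - d t 0.
    by rewrite mxE liftK mxE [X in X + _]mxE [X in _ + X]mxE.
  rewrite first_displacement mulmxBr [LHS]mxE [X in _ + X = _]mxE.
  by rewrite [X in _ = X - _]mxE [X in _ = _ + X - _]mxE yE -/(newton_a (z p) (V p)); ring.
rewrite rotcols_adj_mul ord_pred_lift mulrBr hd (mulmxBr (U p ^t*)) hJ mul_diag_mx.
rewrite [X in _ = - X]mxE [X in _ = - (_ + X)]mxE [X in _ = - (_ - X)]mxE.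
by rewrite [X in _ = - (_ - X * _)]mxE; ring.
Qed.

Lemma zeta_near : mbigO 1 (fun p => zeta p - xi).
Proof.
have h : mbigO 1 (fun p => W p ^t* *m (zeta p - xi)).
  move=> i j; rewrite ord1; case: (unliftP ord0 i) => [t|] ->; last exact: first_ord0.
  exact: bigOW (first_lift t).
have bW : mbigO 0 (fun p => W p) by apply: mbigO_unitary.
apply: mbigO_ext (mbigOMl bW h) => p.
by rewrite mulmxA (unitary_mulC (W_unitary p)) mul1mx.
Qed.

Lemma svd_zeta p : is_svd (jacobian f (zeta p)) (A p) (S' p) (B p).
Proof.
have [hU' hV' pos srt h] := svd_y p; split.
- exact: unitary_prod (U_unitary p) hU'.
- exact: unitary_prod (W_unitary p) hV'.
- exact: pos.
- exact: srt.
rewrite (is_change_jacobian _ (@F_change p)) -/(zeta p) in h.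
have -> : jacobian f (zeta p) =
    U p *m (U p ^t* *m jacobian f (zeta p) *m W p) *m W p ^t*.
  rewrite -!mulmxA (unitary_mulC (W_unitary p)) mulmx1 mulmxA.
  by rewrite (unitary_mulC (U_unitary p)) mul1mx.
by rewrite h /A /B adj_mul !mulmxA.
Qed.

Lemma rotcols_B p : rotcols (B p) = W p *m rotcols (V' p).
Proof. exact: rotcols_mul. Qed.

Lemma newton_g_change p :
  is_change (A p) (rotcols (B p)) f (newton_g f (U p) (V p) (U' p) (V' p)).
Proof.
rewrite rotcols_B; apply: is_change_comp (@F_change p) _.
exact: unitary_change_is_change.
Qed.

Lemma newton_wE p :
  newton_w f (z p) (U p) (V p) (V' p) = rotcols (B p) ^t* *m zeta p.
Proof.
rewrite rotcols_B adj_mul -mulmxA /zeta (mulmxA (W p ^t*)).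
by rewrite (unitary_Cmul (W_unitary p)) mul1mx.
Qed.

(** The last right singular vectors of the two decompositions differ by
    [O(eps)] up to a phase, so the component of order [eps] of [zeta - xi]
    contributes [O(eps^2)] to the other coordinates. *)
Lemma zeta_hat_near j : j != ord_max ->
  bigO 2 (fun p => (B p ^t* *m (zeta p - xi)) j 0).
Proof.
move=> jL; have jz := jacobian_continuous zeta_near f.
apply: (bigO_ext (y := fun p => \sum_l (V' p ^t*) j l * (W p ^t* *m (zeta p - xi)) l 0)).
  by move=> p; rewrite adj_mul -mulmxA mxE.
apply: bigO_sum => l _; case: (unliftP ord0 l) => [t|] ->.
  apply: bigOMl (first_lift t); apply: mbigO_adj; exact: mbigO_unitary.
apply: (bigOM (j := 1) (k := 1)) first_ord0.
apply: (bigO_ext (y := fun p => (\sum_i ((V0 ^t* *m V p) i ord_max)^* *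
    (V0 ^t* *m B p) i j)^* )).
  move=> p; rewrite adjE; congr (_^* ).
  have -> : V' p = W p ^t* *m B p.
    by rewrite /B mulmxA (unitary_Cmul (W_unitary p)) mul1mx.
  rewrite rotcols_adj_mul ord_pred0.
  have [_ v0 _ _ _] := svd0.
  have -> : V p ^t* *m B p = (V0 ^t* *m V p) ^t* *m (V0 ^t* *m B p).
    by rewrite adj_mul adjK mulmxA -(mulmxA _ V0) (unitary_mulC v0) mulmx1.
  by rewrite mxE; apply: eq_bigr => i _; rewrite adjE.
apply: bigO_conj; apply: bigO_sum => i _.
have hPhi := svd_unitaryPhi svd0.
have [->|iL] := eqVneq i ord_max.
  apply: bigOMl.
    apply: bigO_conj; apply: (@mbigO_unitary _ _ eps _ (fun p => V0 ^t* *m V p)) => p.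
    exact: hPhi svd_z p.
  exact: (svd_Phi_row svd0 S0_last S0_neq0 svd_zeta jz).
apply: bigOMr.
  by apply: bigO_conj; exact: (svd_Phi_col svd0 S0_last S0_neq0 svd_z jac_near).
apply: (@mbigO_unitary _ _ eps _ (fun p => V0 ^t* *m B p)) => p.
exact: hPhi svd_zeta p.
Qed.

End FirstStage.

(** The index set of the families: bounds that hold along it are uniform in
    the choice of the point and of both decompositions. *)
Record newton_run (R : realType) m (f : polysys R m.+1) := NewtonRun {
  run_z : 'cV[R[i]]_m.+1;
  run_U : 'M[R[i]]_m.+1; run_S : 'rV[R]_m.+1; run_V : 'M[R[i]]_m.+1;
  run_U' : 'M[R[i]]_m.+1; run_S' : 'rV[R]_m.+1; run_V' : 'M[R[i]]_m.+1;
  run_svd : is_svd (jacobian f run_z) run_U run_S run_V;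
  run_svd' : is_svd (jacobian (newtonF f run_U run_V) (newton_y f run_z run_U run_V))
    run_U' run_S' run_V' }.

Theorem theorem11 (R : realType) (m mu : nat) (hn : (2 <= m.+1)%N) (hmu : (2 <= mu)%N)
    (f : polysys R m.+1) (xi : 'cV[R[i]]_m.+1)
    (hxi : simple_multiple_zero f xi mu) (delta0 : R) (hdelta0 : 0 < delta0) :
  exists K r : R, 0 < r /\
  forall (z : 'cV[R[i]]_m.+1) (U : 'M[R[i]]_m.+1) (S : 'rV[R]_m.+1) (V : 'M[R[i]]_m.+1)
         (U' : 'M[R[i]]_m.+1) (S' : 'rV[R]_m.+1) (V' : 'M[R[i]]_m.+1),
    let F := newtonF f U V in
    let a := newton_a z V in
    let y := newton_y f z U V in
    hnorm (z - xi) < r ->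
    is_svd (jacobian f z) U S V ->
    is_svd (jacobian F y) U' S' V' ->
    delta0 <= sv_gap S ->
    fnorm (jacobian F y - jacobian F a) <= sv_gap S / 5%:R ->
    gamma_hat F a * hnorm (z - xi) < 2%:R^-1 ->
    newton_defined f z U V U' V' mu /\
    hnorm (newton_N f z U V U' V' mu - xi) <= K * hnorm (z - xi) ^+ 2.
Proof.
have [f_xi rk [U0 [S0 [V0 [svd0 S0_last [low top]]]]]] := hxi.
have S0_neq0 := svd_corank1 svd0 S0_last rk.
pose eps (d : newton_run f) := hnorm (run_z d - xi).
have eps_norm d : `|eps d| = hnorm (run_z d - xi) by rewrite ger0_norm ?hnorm_ge0.
have z_near : mbigO eps 1 (fun d => run_z d - xi).
  move=> i j; rewrite ord1; exists 1; apply: near0T => d.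
  by rewrite mul1r expr1 eps_norm; exact: cabs_le_hnorm.
have svd_z := @run_svd R m f; have svd_y := @run_svd' R m f.
have gc := newton_g_change f (@run_U R m f) (@run_V R m f) (@run_U' R m f) (@run_V' R m f).
have hJ := first_jacobian_hat_unit svd0 S0_last S0_neq0 z_near svd_z.
have zn := zeta_near f_xi svd0 S0_last S0_neq0 z_near svd_z.
have zhn := zeta_hat_near f_xi svd0 S0_last S0_neq0 z_near svd_z svd_y.
have hd := second_stage_defined hmu f_xi svd0 S0_last S0_neq0 low top
  (svd_zeta svd_z svd_y) gc zn zhn.
have [K hK] := mbigO_hnorm (second_stage_quadratic hmu f_xi svd0 S0_last S0_neq0 low top
  (svd_zeta svd_z svd_y) gc zn zhn).
have [r r0 hr] := near0I hJ (near0I hd hK).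
exists K, r; split; first exact: r0.
move=> z U S V U' S' V' F a y zr hs hs' _ _ _.
pose d := NewtonRun hs hs'.
have dr : `|eps d| < r by rewrite eps_norm.
have [uJ [[uJ' nz] hN]] := hr d dr.
have hw := newton_wE (@run_V' R m f) svd_z d.
rewrite -hw in uJ' nz.
split; first exact: And3 uJ uJ' nz.
rewrite eps_norm /refined_point -hw rotcols_mul in hN.
exact: hN.
Qed.
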